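(* The following mixed moments hold: $$E[\Delta W_{1}^{4}I_{1,2}I_{2,1}]=2,\quad E[\Delta W_{1}^{2}\Delta W_{2}^{2}I_{1,2}I_{2,1}]=\tfrac{5}{3},$$ $$E[\Delta W_{1}^{6}I_{1,2}I_{2,1}]=15,\quad E[\Delta W_{1}^{4}\Delta W_{2}^{2}I_{1,2}I_{2,1}]=9,\quad E[\Delta W_{1}^{2}I_{1,2}^{2}I_{2,1}^{2}]=\tfrac{49}{20},$$ $$E[\Delta W_{1}^{8}I_{1,2}I_{2,1}]=140,\quad E[\Delta W_{1}^{6}\Delta W_{2}^{2}I_{1,2}I_{2,1}]=65,\quad E[\Delta W_{1}^{4}\Delta W_{2}^{4}I_{1,2}I_{2,1}]=48,$$ $$E[\Delta W_{1}^{4}I_{1,2}^{2}I_{2,1}^{2}]=\tfrac{339}{20},\quad E[\Delta W_{1}^{2}\Delta W_{2}^{2}I_{1,2}^{2}I_{2,1}^{2}]=\tfrac{679}{60}.$$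
   Context: Let $W_{1},W_{2}$ be independent standard (real-valued) Wiener processes and $t\ge0$. Notation: $\Delta W_{j}=W_{j}(t+1)-W_{j}(t)$ for $j=1,2$, and $I_{i,j}=\int_{t}^{t+1}\int_{t}^{s}dW_{i}(r)\,dW_{j}(s)$ (iterated Itô integral) for $i\ne j$. *)

(* Defs.v *)
From HB Require Import structures.
From mathcomp Require Import all_boot all_order all_algebra.
From mathcomp Require Import all_classical all_reals all_analysis.

Set Implicit Arguments.
Unset Strict Implicit.
Unset Printing Implicit Defensive.

Import Order.TTheory GRing.Theory Num.Theory.
Import numFieldNormedType.Exports.

Local Open Scope classical_set_scope.
Local Open Scope ring_scope.

Definition sigma_rv d (T : measurableType d) (R : realType) (X : T -> R) :
    set_system T :=
  preimage_set_system setT X measurable.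

(* Generators of the sigma-algebra of the process restricted to the index
   set D. *)
Definition events_of d (T : measurableType d) (R : realType)
    (W : R -> T -> R) (D : set R) : set_system T :=
  \bigcup_(r in D) sigma_rv (W r).

Definition independent d (T : measurableType d) (R : realType)
    (P : probability T R) (G H : set_system T) : Prop :=
  forall A B, G A -> H B -> P (A `&` B) = (P A * P B)%E.

(* Processes are indexed by R, but only the times r >= 0 are ever used.
   The second parameter of [normal_prob] is the standard deviation. *)
Definition wiener_process d (T : measurableType d) (R : realType)
    (P : probability T R) (W : R -> {RV P >-> R}) : Prop :=
  [/\ {ae P, forall w, W 0 w = 0},
      {ae P, forall w, {within `[0, +oo[, continuous (fun s => W s w)}},
      (forall s u, 0 <= s -> s < u ->
         independent P <<s events_of W `[0, s] >>
           (sigma_rv (fun w => W u w - W s w))) &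
      (forall s u, 0 <= s -> s < u -> forall B, measurable B ->
         P ((fun w => W u w - W s w) @^-1` B)
         = normal_prob 0 (Num.sqrt (u - s)) B)].

Definition independent_processes d (T : measurableType d) (R : realType)
    (P : probability T R) (W1 W2 : R -> {RV P >-> R}) : Prop :=
  independent P <<s events_of W1 `[0, +oo[ >> <<s events_of W2 `[0, +oo[ >>.

(* Filtration generated by (W1, W2), augmented by the null events: Ito
   integrals are only determined up to a null event, and the inner integral of
   an iterated integral has to be adapted. *)
Definition wiener_filtration d (T : measurableType d) (R : realType)
    (P : probability T R) (W1 W2 : R -> {RV P >-> R}) (s : R) : set_system T :=
  <<s events_of W1 `[0, s] `|` events_of W2 `[0, s]
      `|` [set A | measurable A /\ P A = 0%E] >>.

(* The process \sum_(k < n) xi_k 1_(tau_k, tau_(k+1)]. *)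
Record simple_process (T : Type) (R : realType) := SimpleProcess {
  sp_size : nat ;
  sp_time : nat -> R ;
  sp_coef : nat -> T -> R }.

Definition sp_fun (T : Type) (R : realType) (S : simple_process T R)
    (s : R) (w : T) : R :=
  \sum_(k < sp_size S)
    sp_coef S k w * \1_(`]sp_time S k, sp_time S k.+1]) s.

Definition sp_integral (T : Type) (R : realType) (W : R -> T -> R)
    (S : simple_process T R) (w : T) : R :=
  \sum_(k < sp_size S)
    sp_coef S k w * (W (sp_time S k.+1) w - W (sp_time S k) w).

Definition sp_adapted d (T : measurableType d) (R : realType)
    (P : probability T R) (F : R -> set_system T) (a b : R)
    (S : simple_process T R) : Prop :=
  [/\ sp_time S 0 = a, sp_time S (sp_size S) = b &
      forall k, (k < sp_size S)%N ->
        [/\ sp_time S k <= sp_time S k.+1,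
            sigma_rv (sp_coef S k) `<=` F (sp_time S k) &
            ('E_P[(fun w => sp_coef S k w ^+ 2)%R] < +oo)%E]].

Definition ito_integrand d (T : measurableType d) (R : realType)
    (P : probability T R) (F : R -> set_system T) (a b : R)
    (H : R -> T -> R) : Prop :=
  [/\ measurable_fun (`[a, b] `*` [set: T]) (fun z : R * T => H z.1 z.2),
      (forall s, a <= s <= b -> sigma_rv (H s) `<=` F s) &
      (\int[P]_w \int[lebesgue_measure]_(s in `[a, b]) ((H s w) ^+ 2)%:E
        < +oo)%E].

(* X is (a version of) the Ito integral of H over [a, b] with respect to W:
   the L^2(P)-limit of the integrals of simple processes converging to H in
   L^2([a, b] x P). *)
Definition is_ito_integral d (T : measurableType d) (R : realType)
    (P : probability T R) (F : R -> set_system T) (a b : R)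
    (H W : R -> T -> R) (X : T -> R) : Prop :=
  [/\ ito_integrand P F a b H,
      measurable_fun [set: T] X &
      exists S : nat -> simple_process T R,
        [/\ (forall n, sp_adapted P F a b (S n)),
            (\int[P]_w \int[lebesgue_measure]_(s in `[a, b])
               ((H s w - sp_fun (S n) s w) ^+ 2)%:E)%E
              @[n --> \oo] --> 0%E &
            'E_P[(fun w => (X w - sp_integral W (S n) w) ^+ 2)%R]%E
              @[n --> \oo] --> 0%E]].

(* I = int_t^(t+1) int_t^s dV(r) dW(s); J s is the inner integral. *)
Definition is_iterated_ito_integral d (T : measurableType d) (R : realType)
    (P : probability T R) (F : R -> set_system T) (t : R)
    (V W : R -> T -> R) (I : T -> R) : Prop :=
  exists J : R -> T -> R,
    (forall s, t <= s <= t + 1 ->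
       is_ito_integral P F t s (fun _ _ => 1) V (J s)) /\
    is_ito_integral P F t (t + 1) J W I.

(* Main.v *)
Require Import Defs.
From HB Require Import structures.
From mathcomp Require Import all_boot all_order all_algebra.
From mathcomp Require Import all_classical all_reals all_analysis.
From mathcomp Require Import measurable_realfun.
From mathcomp Require Import zify ring lra.
From Stdlib Require BinNat Nnat.

(** Writing X_k, Y_k for the increments of W1, W2 over [t, t + k/n], the iterated
integrals are the L2 limits of the left-point sums I = \sum_k X_k (Y_(k+1) - Y_k)
and K = \sum_k Y_k (X_(k+1) - X_k): by the Ito isometry, the error for the inner
integral is of order 1/n. Expanding (X + p)^a (Y + q)^b (I + X q)^c (K + Y p)^e,
with p and q independent centred Gaussians of variance 1/n, shows that
E[X_k^a Y_k^b I_k^c K_k^e] is n^(-(a+b+2c+2e)/2) times a polynomial in k of degree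
at most (a+b+2c+2e)/2, whose leading coefficient obeys a recursion with six terms,
coming from the second-order terms of the expansion. Taking k = n gives the limit
of the moments; in particular the sums have bounded moments of all orders, which
upgrades L2 convergence to convergence of all mixed moments. *)

Set Implicit Arguments.
Unset Strict Implicit.
Unset Printing Implicit Defensive.

Import Order.TTheory GRing.Theory Num.Theory.
Import numFieldNormedType.Exports.

Local Open Scope classical_set_scope.
Local Open Scope ring_scope.

(** * Moments of a Gaussian walk *)

(** The integrals are known only as L2 limits, through approximating sequences that are not
    explicit, and nothing ensures beforehand that products of four such variables are integrable.
    Hence the Ito isometry is applied to differences of step processes, which exchanges the unknown
    approximations for left-point sums, and the moments of the limit are shown to be finite from
    uniform bounds on the sums.

    The six-term recursion is Ito's formula in discrete form: it applies to monomials x^a y^b i^c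
    k^e the generator of (W1, W2, I, K), which is 1/2 d_xx + y d_x d_k + 1/2 y^2 d_kk + 1/2 d_yy + x
    d_y d_i + 1/2 x^2 d_ii. Give x and y weight 1, and i and k weight 2. A term of the expansion
    with s Gaussian factors lowers the weight by s. For s = 1 its mean is 0. Summation over the
    steps gains one degree for a loss of weight 2, so terms with s > 2 cannot reach the top degree.
    Iterating the summation p times produces the divisor p! of the limit. *)

Fixpoint gaussian_moment (m : nat) : nat :=
  match m with
  | 0 => 1
  | 1 => 0
  | (m'.+1 as n).+1 => n * gaussian_moment m'
  end.

(** * Polynomials in the basis of binomial coefficients *)

Section binomial_polynomials.
Context {R : realType}.
Implicit Types (u v : nat -> R) (x y : R).

(** Polynomials in [k] of degree at most [p]. In the binomial basis summation over [k] is a mere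
    shift of indices, so the top coefficient [x] passes through it unchanged; it is p! times the
    usual leading coefficient. *)
Definition binpoly (p : nat) x u := exists2 c : nat -> R,
  (forall k, u k = \sum_(j < p.+1) c j * 'C(k, j)%:R) & c p = x.

Lemma binpoly0 p : binpoly p 0 (fun=> 0).
Proof. by exists (fun=> 0) => // k; rewrite big1// => j _; rewrite mul0r. Qed.

Lemma binpolyD p x y u v : binpoly p x u -> binpoly p y v ->
  binpoly p (x + y) (fun k => u k + v k).
Proof.
move=> [c uE cx] [e vE ey]; exists (fun j => c j + e j); last by rewrite cx ey.
by move=> k; rewrite uE vE -big_split/=; apply: eq_bigr => j _; rewrite mulrDl.
Qed.

Lemma binpolyZ p a x u : binpoly p x u -> binpoly p (a * x) (fun k => a * u k).
Proof.
move=> [c uE cx]; exists (fun j => a * c j); last by rewrite cx.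
by move=> k; rewrite uE mulr_sumr; apply: eq_bigr => j _; rewrite mulrA.
Qed.

Lemma binpoly_sum p n (x : 'I_n -> R) (u : 'I_n -> nat -> R) :
  (forall i, binpoly p (x i) (u i)) ->
  binpoly p (\sum_(i < n) x i) (fun k => \sum_(i < n) u i k).
Proof.
move=> H; elim: n x u H => [|n IH] x u H.
  rewrite big_ord0; have [c h1 h2] := binpoly0 p; exists c => // k.
  by rewrite big_ord0 -h1.
rewrite big_ord_recl; have [c h1 h2] := binpolyD (H ord0) (IH _ _ (fun i => H (lift ord0 i))).
by exists c => // k; rewrite big_ord_recl -h1.
Qed.

Lemma binpoly_widen p x u : binpoly p x u -> binpoly p.+1 0 u.
Proof.
(* The values of [c] beyond [p] are unconstrained, so they are reset to 0 before the degree is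
   raised. *)
move=> [c uE cx]; exists (fun j => if (j <= p)%N then c j else 0); last first.
  by rewrite ltnn.
move=> k; rewrite big_ord_recr/= ltnn mul0r addr0 uE; apply: eq_bigr => j _.
by rewrite -ltnS ltn_ord.
Qed.

(** Discrete integration: by Pascal's rule the increment of ['C(k, j.+1)] is ['C(k, j)], and
    [u 0 = 0] fixes the constant term. *)
Lemma binpoly_increment p x u v : u 0%N = 0 -> (forall k, u k.+1 = u k + v k) ->
  binpoly p x v -> binpoly p.+1 x u.
Proof.
move=> u0 uS [c vE cx]; exists (fun j => if j is j'.+1 then c j' else 0) => //.
elim=> [|k IH].
  rewrite u0 big1// => -[[|j] jp] _; first by rewrite mul0r.
  by rewrite bin0n mulr0.
rewrite uS vE IH [RHS]big_ord_recl/= mul0r add0r.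
rewrite big_ord_recl/= mul0r add0r -big_split/=; apply: eq_bigr => j _.
by rewrite -mulrDr binS natrD.
Qed.

Lemma cvg_binomial_ratio (j : nat) :
  'C(n, j)%:R / n%:R ^+ j @[n --> \oo] --> (j`!%:R^-1 : R).
Proof.
elim: j => [|j IH].
  have -> : 0`!%:R^-1 = 1 :> R by rewrite invr1.
  by under eq_fun do rewrite bin0; rewrite mulr1; exact: cvg_cst.
have H : (n%:R - j%:R) / n%:R @[n --> \oo] --> (1 : R).
  rewrite -[X in _ --> X]subr0 -(mulr0 j%:R).
  have K : (1 - j%:R * n%:R^-1 : R) @[n --> \oo] --> (1 - j%:R * 0 : R).
    apply: cvgB; first exact: cvg_cst.
    apply: cvgM; first exact: cvg_cst.
    by rewrite -(cvg_shiftS (fun n => n%:R^-1 : R)); exact: cvg_harmonic.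
  apply: (cvg_trans _ K).
  apply: near_eq_cvg; near=> n; rewrite mulrBl divff//.
    by rewrite pnatr_eq0 -lt0n; near: n; exact: nbhs_infty_gt.
have -> : j.+1`!%:R^-1 = (j`!%:R^-1 * 1 * j.+1%:R^-1 : R).
  by rewrite mulr1 factS natrM invfM mulrC.
have K : ('C(n, j)%:R / n%:R ^+ j) * ((n%:R - j%:R) / n%:R) * j.+1%:R^-1
    @[n --> \oo] --> (j`!%:R^-1 * 1 * j.+1%:R^-1 : R).
  by apply: cvgM; [exact: cvgM|exact: cvg_cst].
apply: (cvg_trans _ K).
apply: near_eq_cvg; near=> n; rewrite /=.
have jn : (j <= n)%N by near: n; exact: nbhs_infty_ge.
have n0 : n%:R != 0 :> R.
  by rewrite pnatr_eq0 -lt0n; near: n; exact: nbhs_infty_gt.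
have E : 'C(n, j.+1)%:R = 'C(n, j)%:R * (n%:R - j%:R) / j.+1%:R :> R.
  apply: (canRL (mulfK _)); first by rewrite pnatr_eq0.
  by rewrite -natrB// -!natrM mulnC mul_bin_left mulnC.
rewrite E exprS; field.
by rewrite n0 expf_neq0// nat1r pnatr_eq0.
Unshelve. all: by end_near. Qed.

(** The summand of index [j] is of order n^(j - p), so only [j = p] survives, with the factor 1/p!
    of [cvg_binomial_ratio]. *)
Lemma binpoly_cvg p x u : binpoly p x u ->
  u n / n%:R ^+ p @[n --> \oo] --> x / p`!%:R.
Proof.
move=> [c uE <-].
have -> : c p / p`!%:R = \sum_(j < p.+1) (if j == p :> nat then c p / p`!%:R else 0).
  by rewrite big_ord_recr/= eqxx big1 ?add0r// => j _; rewrite ltn_eqF.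
have -> : (fun n => u n / n%:R ^+ p) =
    fun n => \sum_(j < p.+1) (c j * 'C(n, j)%:R / n%:R ^+ p).
  by apply/funext => n; rewrite uE mulr_suml.
apply: (@cvg_big _ _ +%R 0 xpredT) => [|-[j jp] _ /=]; first exact: add_continuous.
case: eqP => [->|/eqP jp'].
  under eq_fun do rewrite -mulrA.
  by apply: cvgM; [exact: cvg_cst|exact: cvg_binomial_ratio].
have {jp'} jp' : (j < p)%N by rewrite ltn_neqAle jp' -ltnS.
have H0 : (n%:R^-1 ^+ (p - j)) @[n --> \oo] --> (0 : R).
  rewrite -(subnSK jp').
  have H1 : n%:R^-1 @[n --> \oo] --> (0 : R).
    by rewrite -(cvg_shiftS (fun n => n%:R^-1 : R)); exact: cvg_harmonic.
  rewrite -[X in _ --> X](expr0n R (p - j.+1).+1).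
  apply: (@continuous_cvg _ _ _ _ _ _ (fun x : R => x ^+ (p - j.+1).+1)) => //.
  exact: exprn_continuous.
have K : c j * ('C(n, j)%:R / n%:R ^+ j) * n%:R^-1 ^+ (p - j)
    @[n --> \oo] --> (0 : R).
  rewrite -[X in _ --> X](mulr0 (c j * j`!%:R^-1)).
  apply: cvgM => //; apply: cvgM; first exact: cvg_cst.
  exact: cvg_binomial_ratio.
apply: (cvg_trans _ K); apply: near_eq_cvg; near=> n.
have n0 : n%:R != 0 :> R.
  by rewrite pnatr_eq0 -lt0n; near: n; exact: nbhs_infty_gt.
rewrite /= -{2}(subnKC (ltnW jp')) exprD exprVn; field.
by rewrite !expf_neq0.
Unshelve. all: by end_near. Qed.

End binomial_polynomials.

(** * Moments of the walk and their leading coefficients *)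

Section discrete_moments.
Context {R : realType}.

(* One step of the walk (x, y, i, k) -> (x + p, y + q, i + x q, k + y p), for
   independent standard Gaussian p and q, acting on the moments of
   x^a y^b i^c k^d. *)
Definition moment_step (f : nat -> nat -> nat -> nat -> R) a b c d : R :=
  \sum_(i < a.+1) \sum_(j < b.+1) \sum_(l < c.+1) \sum_(m < d.+1)
    ('C(a, i) * 'C(b, j) * 'C(c, l) * 'C(d, m)
     * gaussian_moment (i + m) * gaussian_moment (j + l))%:R
    * f (a - i + l)%N (b - j + m)%N (c - l)%N (d - m)%N.

(** The initial function lists the moments of the point mass at the origin, where the walk
    starts. *)
Definition walk_moment k := iter k moment_step
  (fun a b c d => (a + b + c + d == 0)%N%:R).

(** The coefficients ['C(_, 2)] come from the halved pure second derivatives of the generator,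
    [a * d] and [b * c] from the mixed ones. A truncated subtraction always meets a coefficient 0.
    The value is meaningful when a + b + 2c + 2d = 2p, so the base case stands for zero
    exponents. *)
Fixpoint leading_coef (p a b c d : nat) : nat :=
  match p with
  | 0 => 1
  | p'.+1 =>
     ('C(a, 2) * leading_coef p' (a - 2) b c d
    + a * d * leading_coef p' (a - 1) b.+1 c (d - 1)
    + 'C(d, 2) * leading_coef p' a b.+2 c (d - 2)
    + 'C(b, 2) * leading_coef p' a (b - 2) c d
    + b * c * leading_coef p' a.+1 (b - 1) (c - 1) d
    + 'C(c, 2) * leading_coef p' a.+2 b (c - 2) d)%N
  end.

Let sum_trunc a (F : nat -> R) : (forall i, (a < i)%N -> F i = 0) ->
  (forall i, (2 < i)%N -> F i = 0) ->
  \sum_(i < a.+1) F i = F 0%N + F 1%N + F 2%N.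
Proof.
move=> Fa F2; case: a Fa => [|[|a]] Fa.
- by rewrite big_ord_recl big_ord0 (Fa 1%N)// (Fa 2%N)// !addr0.
- by rewrite !big_ord_recl big_ord0 (Fa 2%N)// !addr0.
- rewrite !big_ord_recl big1/= => [|i _]; last by rewrite F2.
  by rewrite addr0 addrA.
Qed.

(** With four exponents summing to 2, both [i + m] and [j + l] must be even for the Gaussian moments
    not to vanish; exactly six index quadruples remain. *)
Lemma sum_quadratic_terms a b c d (f : nat -> nat -> nat -> nat -> R) :
  \sum_(i < a.+1) \sum_(j < b.+1) \sum_(l < c.+1) \sum_(m < d.+1)
    (if (i + j + l + m == 2)%N then
    ('C(a, i) * 'C(b, j) * 'C(c, l) * 'C(d, m)
     * gaussian_moment (i + m) * gaussian_moment (j + l))%:R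
    * f (a - i + l)%N (b - j + m)%N (c - l)%N (d - m)%N else 0) =
    'C(a, 2)%:R * f (a - 2)%N b c d
    + (a * d)%:R * f (a - 1)%N b.+1 c (d - 1)%N
    + 'C(d, 2)%:R * f a b.+2 c (d - 2)%N
    + 'C(b, 2)%:R * f a (b - 2)%N c d
    + (b * c)%:R * f a.+1 (b - 1)%N (c - 1)%N d
    + 'C(c, 2)%:R * f a.+2 b (c - 2)%N d.
Proof.
set G := fun i j l m : nat => (if (i + j + l + m == 2)%N then
    ('C(a, i) * 'C(b, j) * 'C(c, l) * 'C(d, m)
     * gaussian_moment (i + m) * gaussian_moment (j + l))%:R
    * f (a - i + l)%N (b - j + m)%N (c - l)%N (d - m)%N else 0) : R.
have Ga i j l m : (a < i)%N -> G i j l m = 0.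
  by move=> ai; rewrite /G; case: ifP => // _; rewrite bin_small// !mul0n mul0r.
have Gb i j l m : (b < j)%N -> G i j l m = 0.
  move=> ai; rewrite /G; case: ifP => // _.
  by rewrite (bin_small ai) muln0 !mul0n mul0r.
have Gc i j l m : (c < l)%N -> G i j l m = 0.
  move=> ai; rewrite /G; case: ifP => // _.
  by rewrite (bin_small ai) muln0 !mul0n mul0r.
have Gd i j l m : (d < m)%N -> G i j l m = 0.
  move=> ai; rewrite /G; case: ifP => // _.
  by rewrite (bin_small ai) muln0 !mul0n mul0r.
have G2 i j l m : (2 < i + j + l + m)%N -> G i j l m = 0.
  by move=> s2; rewrite /G; case: ifP => // /eqP s; rewrite s in s2.
transitivity (\sum_(i < a.+1) \sum_(j < b.+1) \sum_(l < c.+1) \sum_(m < d.+1)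
  G i j l m) => //.
rewrite (@sum_trunc a (fun i => \sum_(j < b.+1) \sum_(l < c.+1) \sum_(m < d.+1)
  G i j l m)); last 2 first.
- by move=> i ai; rewrite big1// => j _; rewrite big1// => l _; rewrite big1// => m _; exact: Ga.
- by move=> i ai; rewrite big1// => j _; rewrite big1// => l _; rewrite big1// => m _; apply: G2; lia.
have E1 i : \sum_(j < b.+1) \sum_(l < c.+1) \sum_(m < d.+1) G i j l m =
    \sum_(l < c.+1) \sum_(m < d.+1) G i 0%N l m
    + \sum_(l < c.+1) \sum_(m < d.+1) G i 1%N l m
    + \sum_(l < c.+1) \sum_(m < d.+1) G i 2%N l m.
  rewrite (@sum_trunc b (fun j => \sum_(l < c.+1) \sum_(m < d.+1) G i j l m))//.
  - by move=> j ai; rewrite big1// => l _; rewrite big1// => m _; exact: Gb.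
  - by move=> j ai; rewrite big1// => l _; rewrite big1// => m _; apply: G2; lia.
have E2 i j : \sum_(l < c.+1) \sum_(m < d.+1) G i j l m =
    \sum_(m < d.+1) G i j 0%N m + \sum_(m < d.+1) G i j 1%N m
    + \sum_(m < d.+1) G i j 2%N m.
  rewrite (@sum_trunc c (fun l => \sum_(m < d.+1) G i j l m))//.
  - by move=> l ai; rewrite big1// => m _; exact: Gc.
  - by move=> l ai; rewrite big1// => m _; apply: G2; lia.
have E3 i j l : \sum_(m < d.+1) G i j l m =
    G i j l 0%N + G i j l 1%N + G i j l 2%N.
  rewrite (@sum_trunc d (G i j l))//.
  - by move=> m ai; exact: Gd.
  - by move=> m ai; apply: G2; lia.
(* All 81 terms with indices in {0, 1, 2} are explicit from here on; the test on the index sum is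
   decided by computation. *)
rewrite !E1 !E2 !E3 /G /= !bin0 !bin1 !subn0 !addn0 !(muln0, mul0n, muln1, mul1n).
rewrite !addn1 !addn2 mulr0n !mul0r.
ring.
Qed.

Lemma leading_coefS p a b c d :
  (leading_coef p.+1 a b c d)%:R =
  \sum_(i < a.+1) \sum_(j < b.+1) \sum_(l < c.+1) \sum_(m < d.+1)
    (if (i + j + l + m == 2)%N then
    ('C(a, i) * 'C(b, j) * 'C(c, l) * 'C(d, m)
     * gaussian_moment (i + m) * gaussian_moment (j + l))%:R
    * (leading_coef p (a - i + l)%N (b - j + m)%N (c - l)%N (d - m)%N)%:R else 0)
  :> R.
Proof.
rewrite (sum_quadratic_terms a b c d (fun a b c d => (leading_coef p a b c d)%:R)).
by rewrite -!natrM -!natrD.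
Qed.

(** The increment in [k] of a moment is a combination of moments of weight lower by at least 2,
    which are polynomials of degree at most [p] by induction; summation raises the degree by one.
    The inequality on the weight, instead of an equality, lets the induction reach the terms of
    lower order. *)
Lemma walk_moment_binpoly p a b c d : (a + b + c.*2 + d.*2 <= p.*2)%N ->
  binpoly p (if (a + b + c.*2 + d.*2 == p.*2)%N
             then (leading_coef p a b c d)%:R else 0)
    (fun k => walk_moment k a b c d).
Proof.
elim: p a b c d => [|p IH] a b c d w.
  have [-> -> -> ->] : [/\ a = 0, b = 0, c = 0 & d = 0]%N by split; lia.
  exists (fun=> 1) => // k; rewrite big_ord1 bin0 mulr1.
  elim: k => [//|k IH].
  rewrite /walk_moment iterS -/(walk_moment k) /moment_step !big_ord1.
  by rewrite IH /= mulr1.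
have [w2|w2] := leqP (a + b + c.*2 + d.*2)%N p.*2.
  by rewrite ltn_eqF; [exact: binpoly_widen (IH _ _ _ _ w2)|lia].
set W := (_ == _).
pose T k (i j l m : nat) : R := ('C(a, i) * 'C(b, j) * 'C(c, l) * 'C(d, m)
     * gaussian_moment (i + m) * gaussian_moment (j + l))%:R
    * walk_moment k (a - i + l)%N (b - j + m)%N (c - l)%N (d - m)%N.
apply: (@binpoly_increment _ _ _ _ (fun k =>
  \sum_(i < a.+1) \sum_(j < b.+1) \sum_(l < c.+1) \sum_(m < d.+1)
  (if (i + j + l + m == 0)%N then 0 else T k i j l m))).
- by rewrite /walk_moment/= gtn_eqF//; lia.
- move=> k; rewrite {1}/walk_moment iterS -/(walk_moment k) /moment_step.
  (* The term of order zero, the head of all four nested sums, is the moment at time [k] itself. *)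
  do 4 (rewrite big_ord_recl [in RHS]big_ord_recl [RHS]addrA;
    congr (_ + _)).
  by rewrite /= addr0 !bin0 !subn0 !addn0 !muln1 mul1r.
have -> : (if W then (leading_coef p.+1 a b c d)%:R else 0) =
  \sum_(i < a.+1) \sum_(j < b.+1) \sum_(l < c.+1) \sum_(m < d.+1)
    (if W && (i + j + l + m == 2)%N then
    ('C(a, i) * 'C(b, j) * 'C(c, l) * 'C(d, m)
     * gaussian_moment (i + m) * gaussian_moment (j + l))%:R
    * (leading_coef p (a - i + l)%N (b - j + m)%N (c - l)%N (d - m)%N)%:R else 0)
  :> R.
  case: W => /=; first exact: leading_coefS.
  by rewrite big1// => i _; rewrite big1// => j _; rewrite big1// => l _; rewrite big1.
apply: binpoly_sum => i; apply: binpoly_sum => j.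
apply: binpoly_sum => l; apply: binpoly_sum => m.
have := ltn_ord i; have := ltn_ord j; have := ltn_ord l; have := ltn_ord m.
move: (nat_of_ord i) (nat_of_ord j) (nat_of_ord l) (nat_of_ord m) => {}i {}j {}l {}m.
move=> md lc jb ia.
have [s0|s0] := eqVneq (i + j + l + m)%N 0%N.
  by rewrite s0 andbF; exact: binpoly0.
(* A term of order one contains a single Gaussian factor, whose mean is 0. *)
have [s1|s1] := eqVneq (i + j + l + m)%N 1%N.
  rewrite s1 andbF.
  have -> : (fun k => T k i j l m) = fun=> 0; last exact: binpoly0.
  apply/funext => k; rewrite /T -(mulnA _ (gaussian_moment _)).
  have -> : (gaussian_moment (i + m) * gaussian_moment (j + l) = 0)%N.
    by case: i j l m s1 {s0 ia jb lc md} => [|[|i]] [|[|j]] [|[|l]] [|[|m]]//=; lia.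
  by rewrite muln0 mul0r.
have := IH (a - i + l)%N (b - j + m)%N (c - l)%N (d - m)%N.
have -> : (a - i + l + (b - j + m) + (c - l).*2 + (d - m).*2 =
          a + b + c.*2 + d.*2 - (i + j + l + m))%N by lia.
(* Top degree [p] is reached only if the moment has full weight and the term is of order exactly
   two: from weight 2p + 1 a loss of at least 2 falls below 2p. *)
have -> : (W && (i + j + l + m == 2) =
  (a + b + c.*2 + d.*2 - (i + j + l + m) == p.*2))%N by rewrite /W; lia.
have wp : (a + b + c.*2 + d.*2 - (i + j + l + m) <= p.*2)%N by lia.
move=> /(_ wp)/(binpolyZ ('C(a, i) * 'C(b, j) * 'C(c, l) * 'C(d, m)
     * gaussian_moment (i + m) * gaussian_moment (j + l))%:R).
by case: ifP => // _; rewrite mulr0.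
Qed.

Lemma walk_moment_cvg p a b c d : (a + b + c.*2 + d.*2 = p.*2)%N ->
  walk_moment n a b c d / n%:R ^+ p @[n --> \oo] -->
  ((leading_coef p a b c d)%:R / p`!%:R : R).
Proof.
move=> w; have := @walk_moment_binpoly p a b c d.
by rewrite w eqxx leqnn => /(_ isT)/binpoly_cvg.
Qed.

End discrete_moments.

(** * Means and moments of random variables *)

Section real_inequalities.
Context {R : realType}.
Implicit Types x y : R.

Lemma normM_le_sqr x y : `|x * y| <= x ^+ 2 + y ^+ 2.
Proof.
have := sqr_ge0 (x - y); have := sqr_ge0 (x + y); have := sqr_ge0 x.
have := sqr_ge0 y; rewrite sqrrB sqrrD ler_norml => ? ? ? ?.
by apply/andP; split; lra.
Qed.

Lemma sqrD_le x y : (x + y) ^+ 2 <= 2 * x ^+ 2 + 2 * y ^+ 2.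
Proof. by have := sqr_ge0 (x - y); rewrite sqrrB sqrrD; lra. Qed.

End real_inequalities.

(** Monotone convergence, in a form suited to functions that are controlled only on the sets where
    they are bounded. *)
Lemma integrable_of_truncations d (T : measurableType d) (R : realType)
    (mu : {measure set T -> \bar R}) (A : nat -> set T) (f : T -> R) (C : R) :
  {homo A : m n / (m <= n)%N >-> (m <= n)%O} ->
  (forall n, measurable (A n)) -> \bigcup_n A n = setT ->
  measurable_fun setT f -> (forall x, 0 <= f x) ->
  (forall n, (\int[mu]_(x in A n) (f x)%:E <= C%:E)%E) ->
  mu.-integrable setT (EFin \o f).
Proof.
move=> ndA mA UA mf f0 fC; apply/integrableP; split; first exact/measurable_EFinP.
have H : (\int[mu]_(x in A n) (f x)%:E)%E @[n --> \oo] -->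
    (\int[mu]_x (f x)%:E)%E.
  rewrite -UA; apply: ge0_nondecreasing_set_cvg_integral => //.
  - by move=> n; exact/measurable_EFinP/measurable_funTS.
  - by move=> n x _; rewrite lee_fin.
have -> : (\int[mu]_x `|(EFin \o f) x| = \int[mu]_x (f x)%:E)%E.
  by apply: eq_integral => x _ /=; rewrite ger0_norm.
apply: (@le_lt_trans _ _ C%:E); last exact: ltry.
rewrite -(cvg_lim _ H)//; apply: lime_le; last exact: nearW.
by apply/cvg_ex; eexists; exact: H.
Qed.

Section mean.
Context d (T : measurableType d) (R : realType) (P : probability T R).
Implicit Types (X Y : T -> R) (c : R).

Definition integrable_rv X := P.-integrable [set: T] (EFin \o X).

(** A real-valued expectation, so that [ring] and [lra] apply; it is tied to ['E_P] by integrability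
    in [expectation_mean]. *)
Definition mean X : R := \int[P]_w X w.

Lemma expectation_mean X : integrable_rv X -> 'E_P[X]%E = (mean X)%:E.
Proof. by move=> iX; rewrite unlock /mean /Rintegral fineK// integrable_fin_num. Qed.

Lemma integrable_rv_measurable X : integrable_rv X -> measurable_fun setT X.
Proof. by move=> /integrableP[/measurable_EFinP]. Qed.

Lemma integrable_rv_cst c : integrable_rv (fun=> c).
Proof. exact: finite_measure_integrable_cst. Qed.

Lemma integrable_rvD X Y : integrable_rv X -> integrable_rv Y ->
  integrable_rv (fun w => X w + Y w).
Proof. by move=> iX iY; exact: (integrableD measurableT iX iY). Qed.

Lemma integrable_rvZ c X : integrable_rv X -> integrable_rv (fun w => c * X w).
Proof. by move=> iX; exact: (integrableZl measurableT c iX). Qed.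

Lemma integrable_rvB X Y : integrable_rv X -> integrable_rv Y ->
  integrable_rv (fun w => X w - Y w).
Proof. by move=> iX iY; exact: (integrableB measurableT iX iY). Qed.

Lemma integrable_rv_norm X : integrable_rv X -> integrable_rv (fun w => `|X w|).
Proof. by move=> iX; exact: integrable_norm. Qed.

Lemma integrable_rv_sum I (r : seq I) (F : I -> T -> R) :
  (forall i, integrable_rv (F i)) ->
  integrable_rv (fun w => \sum_(i <- r) F i w).
Proof.
move=> iF; rewrite /integrable_rv.
have -> : EFin \o (fun w => \sum_(i <- r) F i w) =
    fun w => (\sum_(i <- r) (F i w)%:E)%E.
  by apply/funext => w; rewrite sumEFin.
by apply: integrable_sum => // i _; exact: iF.
Qed.

Lemma le_integrable_rv X Y : measurable_fun setT X ->
  (forall w, `|X w| <= Y w) -> integrable_rv Y -> integrable_rv X.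
Proof.
move=> mX XY iY; apply: (le_integrable _ _ _ iY) => //.
- exact/measurable_EFinP.
- by move=> w _ /=; rewrite lee_fin (le_trans (XY w))// ler_norm.
Qed.

Lemma mean_cst c : mean (fun=> c) = c.
Proof.
rewrite /mean Rintegral_cst//; set m := fine _.
by have -> : m = 1; [rewrite /m [X in fine X](probability_setT P)|rewrite mulr1].
Qed.

Lemma meanD X Y : integrable_rv X -> integrable_rv Y ->
  mean (fun w => X w + Y w) = mean X + mean Y.
Proof. by move=> iX iY; exact: RintegralD. Qed.

Lemma meanB X Y : integrable_rv X -> integrable_rv Y ->
  mean (fun w => X w - Y w) = mean X - mean Y.
Proof. by move=> iX iY; exact: RintegralB. Qed.

Lemma meanZ c X : integrable_rv X -> mean (fun w => c * X w) = c * mean X.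
Proof. by move=> iX; exact: RintegralZl. Qed.

Lemma mean_sum I (r : seq I) (F : I -> T -> R) :
  (forall i, integrable_rv (F i)) ->
  mean (fun w => \sum_(i <- r) F i w) = \sum_(i <- r) mean (F i).
Proof.
move=> iF; elim: r => [|i r IH].
  under [in LHS]eq_fun do rewrite big_nil.
  by rewrite big_nil mean_cst.
under [in LHS]eq_fun do rewrite big_cons.
by rewrite meanD ?IH ?big_cons//; exact: integrable_rv_sum.
Qed.

Lemma mean_le X Y : integrable_rv X -> integrable_rv Y ->
  (forall w, X w <= Y w) -> mean X <= mean Y.
Proof. by move=> iX iY XY; apply: le_Rintegral. Qed.

Lemma mean_ge0 X : (forall w, 0 <= X w) -> 0 <= mean X.
Proof. by move=> X0; apply: Rintegral_ge0. Qed.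

Lemma le_mean_norm X : integrable_rv X -> `|mean X| <= mean (fun w => `|X w|).
Proof. by move=> iX; exact: le_normr_Rintegral. Qed.

Definition square_integrable X :=
  measurable_fun setT X /\ integrable_rv (fun w => X w ^+ 2).

Lemma le_integrable_rvM X Y : measurable_fun setT X -> measurable_fun setT Y ->
  integrable_rv (fun w => X w ^+ 2) -> integrable_rv (fun w => Y w ^+ 2) ->
  integrable_rv (fun w => X w * Y w).
Proof.
move=> mX mY iX iY; apply: le_integrable_rv (integrable_rvD iX iY).
  exact: measurable_funM.
by move=> w; exact: normM_le_sqr.
Qed.

Lemma square_integrableM X Y : square_integrable X -> square_integrable Y ->
  integrable_rv (fun w => X w * Y w).
Proof. by move=> [mX iX] [mY iY]; exact: le_integrable_rvM. Qed.

Lemma square_integrableD X Y : square_integrable X -> square_integrable Y ->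
  square_integrable (fun w => X w + Y w).
Proof.
move=> [mX iX] [mY iY]; split; first exact: measurable_funD.
apply: (@le_integrable_rv _ (fun w => 2 * X w ^+ 2 + 2 * Y w ^+ 2)).
- by apply: measurable_funX; exact: measurable_funD.
- by move=> w; rewrite ger0_norm ?sqr_ge0// sqrD_le.
- by apply: integrable_rvD; exact: integrable_rvZ.
Qed.

Lemma square_integrableZ c X : square_integrable X ->
  square_integrable (fun w => c * X w).
Proof.
move=> [mX iX]; split; first exact: measurable_funM.
have -> : (fun w => (c * X w) ^+ 2) = fun w => c ^+ 2 * X w ^+ 2.
  by apply/funext => w; rewrite exprMn.
exact: integrable_rvZ.
Qed.

Lemma square_integrableN X : square_integrable X ->
  square_integrable (fun w => - X w).
Proof.
by move=> /(square_integrableZ (-1)); under eq_fun do rewrite mulN1r.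
Qed.

Lemma square_integrableB X Y : square_integrable X -> square_integrable Y ->
  square_integrable (fun w => X w - Y w).
Proof. by move=> sX /square_integrableN; exact: square_integrableD. Qed.

Lemma square_integrable_cst c : square_integrable (fun=> c).
Proof. by split; [exact: measurable_cst|exact: integrable_rv_cst]. Qed.

Lemma square_integrable_integrable X : square_integrable X -> integrable_rv X.
Proof.
move=> sX; have := square_integrableM sX (square_integrable_cst 1).
by under eq_fun do rewrite mulr1.
Qed.

Lemma square_integrable_sum I (r : seq I) (F : I -> T -> R) :
  (forall i, square_integrable (F i)) -> square_integrable (fun w => \sum_(i <- r) F i w).
Proof.
move=> sF; elim: r => [|i r IH].
  under eq_fun do rewrite big_nil; exact: square_integrable_cst.
under eq_fun do rewrite big_cons.
by apply: square_integrableD => //; exact: IH.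
Qed.

Definition has_moments X := forall n, integrable_rv (fun w => X w ^+ n).

Lemma has_moments_integrable X : has_moments X -> integrable_rv X.
Proof. by move=> /(_ 1%N); under eq_fun do rewrite expr1. Qed.

Lemma has_moments_measurable X : has_moments X -> measurable_fun setT X.
Proof. by move=> /has_moments_integrable/integrable_rv_measurable. Qed.

Lemma has_momentsX X n : has_moments X -> has_moments (fun w => X w ^+ n).
Proof. by move=> hX m; under eq_fun do rewrite -exprM; exact: hX. Qed.

Lemma has_moments_square_integrable X : has_moments X -> square_integrable X.
Proof. by move=> hX; split => //; exact: has_moments_measurable. Qed.

Lemma has_moments_cst c : has_moments (fun=> c).
Proof. by move=> n; exact: integrable_rv_cst. Qed.

Lemma has_momentsM X Y : has_moments X -> has_moments Y ->
  has_moments (fun w => X w * Y w).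
Proof.
move=> hX hY n; under eq_fun do rewrite exprMn.
apply: square_integrableM; apply: has_moments_square_integrable;
  exact: has_momentsX.
Qed.

Lemma has_momentsD X Y : has_moments X -> has_moments Y ->
  has_moments (fun w => X w + Y w).
Proof.
move=> hX hY n; under eq_fun do rewrite exprDn.
apply: integrable_rv_sum => i; under eq_fun do rewrite -mulr_natl.
apply/integrable_rvZ/has_moments_integrable/has_momentsM; exact: has_momentsX.
Qed.

Lemma has_momentsZ c X : has_moments X -> has_moments (fun w => c * X w).
Proof. by move=> hX; apply: has_momentsM => //; exact: has_moments_cst. Qed.

Lemma has_momentsB X Y : has_moments X -> has_moments Y ->
  has_moments (fun w => X w - Y w).
Proof.
move=> hX /(has_momentsZ (-1)); under eq_fun do rewrite mulN1r.
exact: has_momentsD.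
Qed.

Lemma has_moments_sum I (r : seq I) (F : I -> T -> R) :
  (forall i, has_moments (F i)) -> has_moments (fun w => \sum_(i <- r) F i w).
Proof.
move=> sF; elim: r => [|i r IH].
  under eq_fun do rewrite big_nil; exact: has_moments_cst.
under eq_fun do rewrite big_cons.
by apply: has_momentsD => //; exact: IH.
Qed.

(** Since y <= 1 + y^2 with y = |X|^n, all powers are dominated by even ones. *)
Lemma has_moments_even X : measurable_fun setT X ->
  (forall n, integrable_rv (fun w => X w ^+ n.*2)) -> has_moments X.
Proof.
move=> mX iX n.
apply: le_integrable_rv (integrable_rvD (integrable_rv_cst 1) (iX n)).
  exact: measurable_funX.
move=> w; rewrite normrX -muln2 exprM -(real_normK (num_real (X w ^+ n))) normrX.
have := normr_ge0 (X w); set x := `|_|; move: (x ^+ n) => y _.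
nra.
Qed.

(** A weighted substitute for the Cauchy-Schwarz inequality: a small [e] controls the bounded
    factor, and the factor tending to 0 then absorbs [e^-1]. *)
Lemma mean_norm_prod_le X Y e : 0 < e ->
  square_integrable X -> square_integrable Y ->
  mean (fun w => `|X w * Y w|) <=
  e^-1 * mean (fun w => X w ^+ 2) + e * mean (fun w => Y w ^+ 2).
Proof.
move=> e0 sX sY; rewrite -!meanZ; [|exact: sY.2|exact: sX.2].
have iX : integrable_rv (fun w => e^-1 * X w ^+ 2).
  by apply: integrable_rvZ; exact: sX.2.
have iY : integrable_rv (fun w => e * Y w ^+ 2).
  by apply: integrable_rvZ; exact: sY.2.
rewrite -meanD//; apply: mean_le.
- by apply: integrable_rv_norm; exact: square_integrableM.
- exact: integrable_rvD.
- move=> w; have -> : Y w = e^-1 * (e * Y w) by rewrite mulKf// gt_eqF.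
  rewrite mulrCA normrM gtr0_norm ?invr_gt0//.
  have -> : e * (e^-1 * (e * Y w)) ^+ 2 = e^-1 * (e * Y w) ^+ 2.
    by field; rewrite gt_eqF.
  by rewrite -mulrDr ler_pM2l ?invr_gt0// normM_le_sqr.
Qed.

Lemma cvg0_mean_norm_prod (X Y : nat -> T -> R) C :
  (forall n, square_integrable (X n)) -> (forall n, square_integrable (Y n)) ->
  mean (fun w => X n w ^+ 2) @[n --> \oo] --> (0 : R) ->
  (forall n, mean (fun w => Y n w ^+ 2) <= C) ->
  mean (fun w => `|X n w * Y n w|) @[n --> \oo] --> (0 : R).
Proof.
move=> sX sY X0 YC; apply/cvgr0Pnorm_le => e e0.
have C0 : 0 <= C by apply: le_trans (YC 0%N); apply: mean_ge0 => w; exact: sqr_ge0.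
(* This weight makes each of the two terms at most [e / 2]; [C + 1] replaces [C] because [C] may be
   0. *)
pose a := e / (2 * (C + 1)).
have a0 : 0 < a by rewrite divr_gt0// mulr_gt0// ltr_wpDl.
have aC : a * (C + 1) = e / 2 by rewrite /a; field; lra.
clearbody a; near=> n.
rewrite ger0_norm; last by apply: mean_ge0.
apply: (le_trans (mean_norm_prod_le a0 (sX n) (sY n))).
have -> : e = e / 2 + e / 2 by lra.
apply: lerD.
  rewrite ler_pdivrMl//.
  have : `|mean (fun w => X n w ^+ 2)| <= a * (e / 2).
    near: n; move/cvgr0Pnorm_le : X0; apply.
    by apply: mulr_gt0 => //; exact: divr_gt0.
  by move=> H; exact: (le_trans (ler_norm _) H).
apply: (@le_trans _ _ (a * (C + 1))).
  rewrite ler_pM2l//; apply: (le_trans (YC n)); lra.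
by rewrite aC.
Unshelve. all: by end_near. Qed.

End mean.

(** * Convergence of moments *)

Section moment_convergence.
Context d (T : measurableType d) (R : realType) (P : probability T R).
Implicit Types (X Y : T -> R) (U V : nat -> T -> R).
Local Notation mean := (mean P).
Local Notation has_moments := (has_moments P).
Local Notation integrable_rv := (integrable_rv P).
Local Notation square_integrable := (square_integrable P).

Definition bounded_moments U := (forall n, has_moments (U n)) /\
  forall p, exists C, forall n, mean (fun w => U n w ^+ p.*2) <= C.

Lemma bounded_moments_cst X : has_moments X -> bounded_moments (fun=> X).
Proof. by move=> hX; split => // p; exists (mean (fun w => X w ^+ p.*2)). Qed.

Lemma bounded_momentsM U V : bounded_moments U -> bounded_moments V ->
  bounded_moments (fun n w => U n w * V n w).
Proof.
move=> [hU bU] [hV bV]; split=> [n|p]; first exact: has_momentsM.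
have [C1 H1] := bU p.*2; have [C2 H2] := bV p.*2; exists (C1 + C2) => n.
apply: le_trans (lerD (H1 n) (H2 n)).
rewrite -meanD//; [|exact: hU|exact: hV]; apply: mean_le.
- exact: has_momentsM.
- by apply: integrable_rvD; [exact: hU|exact: hV].
- move=> w; rewrite exprMn; apply: le_trans (ler_norm _) _.
  by rewrite -(muln2 p.*2) !exprM normM_le_sqr.
Qed.

Lemma sqrD_exp_le (x y : R) p :
  (x + y) ^+ p.*2 <= 4 ^+ p * (x ^+ p.*2 + y ^+ p.*2).
Proof.
rewrite -mul2n !exprM.
wlog xy : x y / x ^+ 2 <= y ^+ 2.
  move=> H; have [/H//|/ltW/H] := leP (x ^+ 2) (y ^+ 2).
  by rewrite (addrC x) [in leRHS]addrC.
apply: (@le_trans _ _ ((4 * y ^+ 2) ^+ p)).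
  have H : (x + y) ^+ 2 <= 4 * y ^+ 2 by apply: (le_trans (sqrD_le _ _)); lra.
  by apply: lerXn2r => //; rewrite nnegrE ?sqr_ge0// mulr_ge0// sqr_ge0.
by rewrite exprMn ler_pM2l ?exprn_gt0// lerDr exprn_ge0// sqr_ge0.
Qed.

Lemma bounded_momentsD U V : bounded_moments U -> bounded_moments V ->
  bounded_moments (fun n w => U n w + V n w).
Proof.
move=> [hU bU] [hV bV]; split=> [n|p]; first exact: has_momentsD.
have [C1 H1] := bU p; have [C2 H2] := bV p; exists (4 ^+ p * (C1 + C2)) => n.
have H : mean (fun w => U n w ^+ p.*2 + V n w ^+ p.*2) <= C1 + C2.
  by rewrite meanD; [exact: lerD (H1 n) (H2 n)|exact: hU|exact: hV].
have iUV : integrable_rv (fun w => U n w ^+ p.*2 + V n w ^+ p.*2).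
  by apply: integrable_rvD; [exact: hU|exact: hV].
apply: (@le_trans _ _ (4 ^+ p * mean (fun w => U n w ^+ p.*2 + V n w ^+ p.*2))).
  rewrite -meanZ//; apply: mean_le.
  - exact: has_momentsD.
  - exact: integrable_rvZ.
  - by move=> w; exact: sqrD_exp_le.
by rewrite ler_pM2l// exprn_gt0.
Qed.

Lemma bounded_momentsN U : bounded_moments U ->
  bounded_moments (fun n w => - U n w).
Proof.
move=> bU; under [X in bounded_moments X]eq_fun => n do
  [under eq_fun do rewrite -mulN1r].
apply: (@bounded_momentsM (fun _ _ => -1)) => //.
exact/bounded_moments_cst/has_moments_cst.
Qed.

Lemma bounded_momentsB U V : bounded_moments U -> bounded_moments V ->
  bounded_moments (fun n w => U n w - V n w).
Proof. by move=> bU /bounded_momentsN; exact: bounded_momentsD. Qed.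

Lemma cvg0_mean_norm_prod_bounded (X : nat -> T -> R) U :
  (forall n, square_integrable (X n)) -> bounded_moments U ->
  mean (fun w => X n w ^+ 2) @[n --> \oo] --> (0 : R) ->
  mean (fun w => `|X n w * U n w|) @[n --> \oo] --> (0 : R).
Proof.
move=> sX [hU /(_ 1%N)[C HC]] X0; apply: (cvg0_mean_norm_prod _ _ X0 HC) => // n.
exact: has_moments_square_integrable.
Qed.

(** L2 convergence alone is not stable under products; together with bounded moments it is. *)
Definition moment_cvg U X := [/\ bounded_moments U, has_moments X &
  mean (fun w => (U n w - X w) ^+ 2) @[n --> \oo] --> (0 : R)].

Lemma moment_cvg_cst X : has_moments X -> moment_cvg (fun=> X) X.
Proof.
move=> hX; split => //; first exact: bounded_moments_cst.
have -> : mean (fun w => (X w - X w) ^+ 2) = 0; last exact: cvg_cst.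
by under eq_fun do rewrite subrr expr0n; exact: mean_cst.
Qed.

Lemma cvg_mean_le0 (u v : nat -> R) : (forall n, 0 <= u n) -> (forall n, u n <= v n) ->
  v n @[n --> \oo] --> (0 : R) -> u n @[n --> \oo] --> (0 : R).
Proof.
move=> u0 uv v0; apply: (@squeeze_cvgr _ _ _ _ (fun=> 0) v) => //.
  by apply: nearW => n; rewrite u0 uv.
exact: cvg_cst.
Qed.

(** Write UV - XY = (U - X)V + (V - Y)X. The square of the first summand is (U - X) times (U -
    X)V^2, where the first factor tends to 0 in L2 and the second has bounded moments; the other
    summand is treated alike. *)
Lemma moment_cvgM U V X Y : moment_cvg U X -> moment_cvg V Y ->
  moment_cvg (fun n w => U n w * V n w) (fun w => X w * Y w).
Proof.
move=> [bU hX UX] [bV hY VY]; split; [exact: bounded_momentsM|exact: has_momentsM|].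
have bX := bounded_moments_cst hX; have bY := bounded_moments_cst hY.
have bUX := bounded_momentsB bU bX; have bVY := bounded_momentsB bV bY.
have bUXV := bounded_momentsM bUX (bounded_momentsM bV bV).
have bVYX := bounded_momentsM bVY (bounded_momentsM bX bX).
have H1 := cvg0_mean_norm_prod_bounded
  (fun n => has_moments_square_integrable (bUX.1 n)) bUXV UX.
have H2 := cvg0_mean_norm_prod_bounded
  (fun n => has_moments_square_integrable (bVY.1 n)) bVYX VY.
have i1 n := integrable_rv_norm (has_moments_integrable
  ((bounded_momentsM bUX bUXV).1 n)).
have i2 n := integrable_rv_norm (has_moments_integrable
  ((bounded_momentsM bVY bVYX).1 n)).
have H3 : (2 * mean (fun w => `|(U n w - X w) * ((U n w - X w) * (V n w * V n w))|) +
  2 * mean (fun w => `|(V n w - Y w) * ((V n w - Y w) * (X w * X w))|))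
  @[n --> \oo] --> (0 : R).
  have -> : (0 : R) = 2 * 0 + 2 * 0 by rewrite mulr0 addr0.
  by apply: cvgD; apply: cvgM => //; exact: cvg_cst.
apply: cvg_mean_le0 H3 => n; first by apply: mean_ge0 => w; exact: sqr_ge0.
rewrite -!meanZ; [|exact: i2|exact: i1].
rewrite -meanD; [|exact: integrable_rvZ (i1 n)|exact: integrable_rvZ (i2 n)].
apply: mean_le.
- by apply: (has_momentsB (has_momentsM (bU.1 n) (bV.1 n)) (has_momentsM hX hY)).
- by apply: integrable_rvD; apply: integrable_rvZ; [exact: i1|exact: i2].
- move=> w; have -> : U n w * V n w - X w * Y w =
    (U n w - X w) * V n w + (V n w - Y w) * X w by ring.
  apply: (le_trans (sqrD_le _ _)); apply: lerD; rewrite ler_pM2l//.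
    by rewrite exprMn mulrA -!expr2 ger0_norm// mulr_ge0// sqr_ge0.
  by rewrite exprMn mulrA -!expr2 ger0_norm// mulr_ge0// sqr_ge0.
Qed.

Lemma moment_cvgX U X p : moment_cvg U X ->
  moment_cvg (fun n w => U n w ^+ p) (fun w => X w ^+ p).
Proof.
move=> UX; elim: p => [|p IH].
  exact/moment_cvg_cst/has_moments_cst.
under [X in moment_cvg _ X]eq_fun do rewrite exprS.
under [X in moment_cvg X _]eq_fun => n do [under eq_fun do rewrite exprS].
exact: moment_cvgM.
Qed.

Lemma moment_cvg_mean U X : moment_cvg U X ->
  mean (U n) @[n --> \oo] --> mean X.
Proof.
move=> [bU hX UX]; apply/subr_cvg0.
have b1 := bounded_moments_cst (has_moments_cst P 1).
have bUX := bounded_momentsB bU (bounded_moments_cst hX).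
have H := cvg0_mean_norm_prod_bounded
  (fun n => has_moments_square_integrable (bUX.1 n)) b1 UX.
apply/norm_cvg0P; apply: cvg_mean_le0 H => // n.
rewrite -meanB; [|exact: has_moments_integrable (bU.1 n)|exact: has_moments_integrable].
have -> : (fun w => `|(U n w - X w) * 1|) = fun w => `|U n w - X w|.
  by apply/funext => w; rewrite mulr1.
by apply/le_mean_norm/has_moments_integrable/(bUX.1 n).
Qed.

(* On the event [|Z| <= M] the square of [Z] is compared with [Z * Z_n]. *)
Lemma square_integrable_of_cvg (Z : nat -> T -> R) X C :
  (forall n, square_integrable (Z n)) ->
  (forall n, mean (fun w => Z n w ^+ 2) <= C) ->
  integrable_rv X ->
  mean (fun w => `|Z n w - X w|) @[n --> \oo] --> (0 : R) ->
  integrable_rv (fun w => X w ^+ 2).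
Proof.
move=> sZ ZC iX ZX; have mX := integrable_rv_measurable iX.
pose A M := [set w | `|X w| <= M%:R].
have mA M : measurable (A M).
  rewrite /A -[X in measurable X]setTI.
  apply: (@measurable_fun_le _ _ _ _ (fun w => `|X w|) (fun=> M%:R)) => //.
  exact: measurableT_comp.
have mI M : measurable_fun setT (\1_(A M) : T -> R) by exact: measurable_indic.
pose g M w := X w * \1_(A M) w.
have gM M w : `|g M w| <= M%:R.
  rewrite /g normrM indicE; have [|_] := boolP (w \in A M).
    by rewrite inE /A/= normr1 mulr1.
  by rewrite normr0 mulr0.
have mg M : measurable_fun setT (g M) by exact: measurable_funM.
have sg M : square_integrable (g M).
  split => //; apply: le_integrable_rv (integrable_rv_cst P (M%:R ^+ 2)).
    exact: measurable_funX.
  move=> w; rewrite ger0_norm ?sqr_ge0// -(real_normK (num_real (g M w))).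
  by rewrite ler_pXn2r ?nnegrE.
have gg M w : g M w * X w = g M w ^+ 2.
  rewrite /g indicE; case: (w \in A M); last by rewrite mulr0 mul0r expr0n.
  by rewrite mulr1.
have gC M : mean (fun w => g M w ^+ 2) <= C.
  suff H e : 0 < e -> mean (fun w => g M w ^+ 2) <= C + e.
    by apply/ler_addgt0Pr.
  move=> e0.
  (* The index [n] depends on [M]. The error [e / 2] turns into [e] when half of the mean of
     [g M w ^+ 2] is moved to the left-hand side; [M.+1] serves as a nonzero divisor. *)
  have [n nM] : exists n, M%:R * mean (fun w => `|Z n w - X w|) <= e / 2.
    have M0 : 0 < (M.+1%:R : R) by [].
    have e2 : 0 < e / 2 / M.+1%:R by rewrite !divr_gt0.
    move/cvgr0Pnorm_le : ZX => /(_ _ e2)[n _ /(_ n (leqnn n)) H]; exists n.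
    rewrite ger0_norm ?mean_ge0// ler_pdivlMr// in H.
    apply: le_trans H; rewrite mulrC ler_wpM2l ?mean_ge0//.
    by rewrite ler_nat.
  have iZX : integrable_rv (fun w => `|Z n w - X w|).
    apply: integrable_rv_norm; apply: integrable_rvB => //.
    exact: square_integrable_integrable.
  have i1 : integrable_rv (fun w => 2^-1 * (g M w ^+ 2 + Z n w ^+ 2)).
    by apply/integrable_rvZ/integrable_rvD; [exact: (sg M).2|exact: (sZ n).2].
  have i2 : integrable_rv (fun w => M%:R * `|Z n w - X w|) by exact: integrable_rvZ.
  have := @mean_le _ _ _ P _ _ (sg M).2 (integrable_rvD i1 i2).
  rewrite meanD// !meanZ//; last first.
    by apply: integrable_rvD; [exact: (sg M).2|exact: (sZ n).2].
  rewrite meanD; [|exact: (sg M).2|exact: (sZ n).2].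
  have : forall w, g M w ^+ 2 <=
      2^-1 * (g M w ^+ 2 + Z n w ^+ 2) + M%:R * `|Z n w - X w|.
    move=> w; rewrite -{1}gg.
    have -> : g M w * X w = g M w * Z n w + g M w * (X w - Z n w) by ring.
    apply: lerD.
      by have := sqr_ge0 (g M w - Z n w); rewrite sqrrB; lra.
    apply: (le_trans (ler_norm _)); rewrite normrM distrC.
    by rewrite ler_wpM2r.
  by move=> H /(_ H); have := ZC n; lra.
apply: (@integrable_of_truncations _ _ _ _ A _ C) => //.
- move=> m n mn; apply/subsetPset => w; rewrite /A/= => /le_trans; apply.
  by rewrite ler_nat.
- rewrite -subTset => w _; exists (Num.truncn `|X w|).+1 => //=.
  by rewrite /A/= ltW// truncnS_gt.
- exact: measurable_funX.
- by move=> w; exact: sqr_ge0.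
move=> M; rewrite integral_mkcond.
have -> : (\int[P]_w ((fun w => (X w ^+ 2)%:E) \_ (A M)) w)%E =
    (mean (fun w => g M w ^+ 2))%:E.
  rewrite /mean /Rintegral fineK; last exact: integrable_fin_num (sg M).2.
  apply: eq_integral => w _; rewrite patchE /g indicE.
  by case: (w \in A M); rewrite ?mulr1// mulr0 expr0n.
by rewrite lee_fin.
Qed.

(** Each term of the factorization of x^(q+1) - y^(q+1) is at most the q-th power of the larger of
    |x| and |y|. The right-hand side is a product to which [cvg0_mean_norm_prod] applies. *)
Lemma exp_sub_le (x y : R) q :
  `|x ^+ q.+1 - y ^+ q.+1| <= `|(x - y) * (q.+1%:R * (`|x| ^+ q + `|y| ^+ q))|.
Proof.
rewrite subrXX !normrM ler_wpM2l// (ger0_norm (ler0n _ _)).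
rewrite (@ger0_norm _ (_ + _)) ?addr_ge0 ?exprn_ge0//.
apply: (le_trans (ler_norm_sum _ _ _)).
rewrite mulr_natl -[in leRHS](card_ord q.+1) -sumr_const.
apply: ler_sum => i _; rewrite normrM !normrX succnK.
have iq : (i <= q)%N by rewrite -ltnS.
move: (nat_of_ord i) iq => {}i iq; have [xy|xy] := leP `|x| `|y|.
  apply: (@le_trans _ _ (`|y| ^+ q)); last by rewrite lerDr exprn_ge0.
  rewrite -{2}(subnK iq) exprD ler_wpM2r ?exprn_ge0//.
  by rewrite lerXn2r ?nnegrE.
apply: (@le_trans _ _ (`|x| ^+ q)); last by rewrite lerDl exprn_ge0.
rewrite -{2}(subnK iq) exprD ler_wpM2l ?exprn_ge0//.
by rewrite lerXn2r ?nnegrE// ltW.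
Qed.

(** The moments of [X] are gained one exponent at a time. If X^q is square integrable, [exp_sub_le]
    gives U^(q+1) -> X^(q+1) in L1; as the U^(q+1) are bounded in L2, the limit X^(q+1) is square
    integrable too. *)
Lemma moment_cvg_of_square U X : bounded_moments U -> measurable_fun setT X ->
  (forall n, integrable_rv (fun w => (U n w - X w) ^+ 2)) ->
  mean (fun w => (U n w - X w) ^+ 2) @[n --> \oo] --> (0 : R) ->
  moment_cvg U X.
Proof.
move=> bU mX iUX UX; split => //; apply: has_moments_even => // q.
have sU n := has_moments_square_integrable (bU.1 n).
have mU n := (sU n).1.
have sUX n : square_integrable (fun w => U n w - X w).
  by split => //; exact: measurable_funB.
have sX : square_integrable X.
  have := square_integrableB (sU 0%N) (sUX 0%N).
  by under eq_fun do rewrite opprB addrC subrK.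
elim: q => [|q IH].
  by under eq_fun do rewrite expr0; exact: integrable_rv_cst.
have mXq m : measurable_fun setT (fun w => `|X w| ^+ m).
  by apply: measurable_funX; exact: measurableT_comp.
have mUq n m : measurable_fun setT (fun w => `|U n w| ^+ m).
  by apply: measurable_funX; exact: measurableT_comp.
have norm_even (x : R) m : (`|x| ^+ m) ^+ 2 = x ^+ m.*2.
  by rewrite -exprM muln2 -mul2n !exprM real_normK// num_real.
have sXq : square_integrable (fun w => `|X w| ^+ q).
  by split => //; under eq_fun do rewrite norm_even.
have sUq n : square_integrable (fun w => `|U n w| ^+ q).
  by split => //; under eq_fun do rewrite norm_even; exact: bU.1.
have [C HC] := bU.2 q.
pose S n w := q.+1%:R * (`|U n w| ^+ q + `|X w| ^+ q).
have sS n : square_integrable (S n).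
  exact/square_integrableZ/square_integrableD.
have SC n : mean (fun w => S n w ^+ 2) <=
    q.+1%:R ^+ 2 * (2 * C + 2 * mean (fun w => X w ^+ q.*2)).
  apply: (@le_trans _ _ (mean (fun w => q.+1%:R ^+ 2 *
      (2 * U n w ^+ q.*2 + 2 * X w ^+ q.*2)))).
    apply: mean_le.
    - exact: (sS n).2.
    - by apply/integrable_rvZ/integrable_rvD; apply: integrable_rvZ => //; exact: bU.1.
    - move=> w; rewrite /S exprMn ler_pM2l ?exprn_gt0//.
      by apply: (le_trans (sqrD_le _ _)); rewrite !norm_even.
  rewrite meanZ; last first.
    by apply: integrable_rvD; apply: integrable_rvZ => //; exact: bU.1.
  rewrite meanD; [|apply: integrable_rvZ; exact: bU.1|exact: integrable_rvZ].
  rewrite !meanZ//; last exact: bU.1.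
  by rewrite ler_pM2l ?exprn_gt0// lerD2r ler_pM2l.
have H := cvg0_mean_norm_prod sUX sS UX SC.
have sUq1 n : square_integrable (fun w => U n w ^+ q.+1).
  exact/has_moments_square_integrable/has_momentsX/bU.1.
have mXq1 : measurable_fun setT (fun w => X w ^+ q.+1) by exact: measurable_funX.
have iXq : integrable_rv (fun w => X w ^+ q.+1).
  apply: le_integrable_rv (integrable_rv_norm (square_integrableM sX sXq)) => //.
  by move=> w; rewrite normrM !normrX normr_id exprS.
have [C' HC'] := bU.2 q.+1.
have sqE (Y : T -> R) : (fun w => Y w ^+ q.+1.*2) = fun w => (Y w ^+ q.+1) ^+ 2.
  by apply/funext => w; rewrite -exprM muln2.
rewrite sqE; apply: (@square_integrable_of_cvg (fun n w => U n w ^+ q.+1) _ C') => //.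
  by move=> n; rewrite -sqE.
apply: cvg_mean_le0 H => n; first exact: mean_ge0.
apply: mean_le.
- apply: integrable_rv_norm; apply: integrable_rvB => //.
  exact: square_integrable_integrable.
- exact/integrable_rv_norm/square_integrableM.
- by move=> w; exact: exp_sub_le.
Qed.

End moment_convergence.

(** * Independence *)

Section independence.
Context d (T : measurableType d) (R : realType) (P : probability T R).
Implicit Types (X Y : T -> R) (G : set_system T).
Local Notation mean := (mean P).
Local Notation integrable_rv := (integrable_rv P).

(** Independence says that the joint law of (X, Y) is the product of the two laws; the claim is then
    Fubini's theorem for (x, y) -> x y. *)
Lemma independent_meanM X Y : independent P (sigma_rv X) (sigma_rv Y) ->
  integrable_rv X -> integrable_rv Y ->
  integrable_rv (fun w => X w * Y w) /\
  mean (fun w => X w * Y w) = mean X * mean Y.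
Proof.
move=> XY iX iY.
have mX := integrable_rv_measurable iX; have mY := integrable_rv_measurable iY.
pose X' : {mfun T >-> R} := HB.pack X (isMeasurableFun.Build _ _ _ _ X mX).
pose Y' : {mfun T >-> R} := HB.pack Y (isMeasurableFun.Build _ _ _ _ Y mY).
pose DX := distribution P X'; pose DY := distribution P Y'.
pose Z w := (X w, Y w).
have mZ : measurable_fun setT Z by exact: measurable_fun_pair.
pose Z' : {mfun T >-> (R * R)%type} := HB.pack Z (isMeasurableFun.Build _ _ _ _ Z mZ).
have DE A : measurable A -> (DX \x DY)%E A = distribution P Z' A.
  apply: product_measure_unique => B C mB mC.
  rewrite /distribution /pushforward -XY; last 2 first.
  - by exists B => //; rewrite setTI.
  - by exists C => //; rewrite setTI.
  by [].
have iXR : DX.-integrable setT (EFin : R -> \bar R).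
  by apply: integrable_pushforward.
have iYR : DY.-integrable setT (EFin : R -> \bar R).
  by apply: integrable_pushforward.
pose f := EFin \o (fun z : R * R => z.1 * z.2).
have mf : measurable_fun setT f.
  by apply/measurable_EFinP; apply: measurable_funM.
have iD : (DX \x DY)%E.-integrable setT f.
  apply/integrable12ltyP => //.
  have mabs : measurable_fun setT (fun y : R => `|y%:E|%E).
    by apply: measurableT_comp.
  have E x : (\int[DY]_y `|f (x, y)| = `|x%:E| * \int[DY]_y `|y%:E|)%E.
    rewrite -ge0_integralZl//.
    by apply: eq_integral => y _; rewrite /f/= normrM EFinM.
  under eq_integral do rewrite E.
  rewrite ge0_integralZr//; last by apply: integral_ge0.
  case/integrableP : iXR => _ ?; case/integrableP : iYR => _ ?.
  by apply: lte_mul_pinfty => //; [exact: integral_ge0|rewrite ge0_fin_numE// integral_ge0].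
have iXY : integrable_rv (fun w => X w * Y w).
  have : (distribution P Z').-integrable setT f.
    case/integrableP : iD => _ iD; apply/integrableP; split => //.
    rewrite (_ : (\int[_]_x _)%E = (\int[DX \x DY]_z `|f z|)%E)//.
    by apply: eq_measure_integral => A mA _; exact/esym/DE.
  case/integrableP => _ H; apply/integrableP; split.
    by apply/measurable_EFinP; exact: measurable_funM.
  rewrite ge0_integral_distribution// in H.
  exact: measurableT_comp.
split => //.
have -> : mean (fun w => X w * Y w) = fine (\int[DX \x DY]_z f z)%E.
  rewrite (eq_measure_integral (distribution P Z')); last first.
    by move=> A mA _; exact: DE.
  by rewrite integral_distribution.
rewrite -integral12_prod_meas1//.
have E x : (fubini_F DY f x = x%:E * \int[DY]_y y%:E)%E.
  rewrite /fubini_F -integralZl//.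
have EY : (\int[DY]_y y%:E = (mean Y)%:E)%E.
  rewrite integral_distribution//= /mean /Rintegral fineK//.
  exact: integrable_fin_num.
under eq_integral do rewrite E EY.
rewrite integralZr// integral_distribution// fineM//.
exact: integrable_fin_num.
Qed.

Definition adapted G X := sigma_rv X `<=` <<s G>>.

(** Seen as measurability for another sigma-algebra on [T], adaptedness inherits stability under
    algebraic operations. *)
Lemma adaptedE G X :
  adapted G X <-> measurable_fun [set: g_sigma_algebraType G] X.
Proof.
split=> [H _ B mB|H _ [B mB <-]]; last exact: H.
by apply: H; exists B.
Qed.

Lemma adapted_cst G c : adapted G (fun=> c).
Proof. by apply/adaptedE; exact: measurable_cst. Qed.

Lemma adaptedD G X Y : adapted G X -> adapted G Y ->
  adapted G (fun w => X w + Y w).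
Proof. by move=> /adaptedE ? /adaptedE ?; apply/adaptedE; exact: measurable_funD. Qed.

Lemma adaptedB G X Y : adapted G X -> adapted G Y ->
  adapted G (fun w => X w - Y w).
Proof. by move=> /adaptedE ? /adaptedE ?; apply/adaptedE; exact: measurable_funB. Qed.

Lemma adaptedM G X Y : adapted G X -> adapted G Y ->
  adapted G (fun w => X w * Y w).
Proof. by move=> /adaptedE ? /adaptedE ?; apply/adaptedE; exact: measurable_funM. Qed.

Lemma adaptedX G X n : adapted G X -> adapted G (fun w => X w ^+ n).
Proof. by move=> /adaptedE ?; apply/adaptedE; exact: measurable_funX. Qed.

Lemma adapted_sub G H X : G `<=` H -> adapted G X -> adapted H X.
Proof. by move=> GH GX A /GX; exact: sub_sigma_algebra2. Qed.

Lemma adapted_measurable G X : G `<=` measurable -> adapted G X ->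
  measurable_fun setT X.
Proof.
move=> Gm GX _ B mB; have /GX : sigma_rv X (setT `&` X @^-1` B) by exists B.
by apply: smallest_sub => //; exact: sigma_algebra_measurable.
Qed.

Lemma sigma_rv_comp X (f : R -> R) : measurable_fun setT f ->
  sigma_rv (fun w => f (X w)) `<=` sigma_rv X.
Proof.
move=> mf _ [B mB <-]; exists (f @^-1` B) => //.
by rewrite -[X in measurable X]setTI; exact: mf.
Qed.

Lemma independent_sub (G H G' H' : set_system T) : G `<=` G' -> H `<=` H' ->
  independent P G' H' -> independent P G H.
Proof. by move=> GG HH I A B /GG GA /HH HB; exact: I. Qed.

Definition null_events : set_system T := [set A | measurable A /\ P A = 0%E].

(** The product rule is assumed on intersections [a] [&] [b] only, and is extended to the generated,
    completed sigma-algebra by uniqueness of measures on a system stable under intersection. *)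
Lemma independent_join (A B C : set_system T) :
  A `<=` measurable -> B `<=` measurable -> C `<=` measurable ->
  (forall a b c, <<s A>> a -> <<s B>> b -> C c ->
    P (a `&` b `&` c) = (P (a `&` b) * P c)%E) ->
  independent P <<s A `|` B `|` null_events>> C.
Proof.
move=> Am Bm Cm H E c sE Cc.
have sAm : <<s A>> `<=` measurable.
  by apply: smallest_sub => //; exact: sigma_algebra_measurable.
have sBm : <<s B>> `<=` measurable.
  by apply: smallest_sub => //; exact: sigma_algebra_measurable.
have sAT : <<s A>> setT by exact: (@measurableT _ (g_sigma_algebraType A)).
have sBT : <<s B>> setT by exact: (@measurableT _ (g_sigma_algebraType B)).
have mc := Cm _ Cc.
(* The condition on all [e] expresses that [E] and [a] [&] [b] differ by a null set; in this form it
   is readily seen to be stable under intersection. *)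
pose G := [set E | measurable E /\ exists a b, [/\ <<s A>> a, <<s B>> b &
  forall e, measurable e -> P (E `&` e) = P (a `&` b `&` e)]].
have GT : G setT by split => //; exists setT, setT; split => //; rewrite setTI.
have GI : setI_closed G.
  move=> E1 E2 [mE1 [a1 [b1 [Aa1 Bb1 H1]]]] [mE2 [a2 [b2 [Aa2 Bb2 H2]]]].
  split; first exact: measurableI.
  exists (a1 `&` a2), (b1 `&` b2); split.
  - exact: (@measurableI _ (g_sigma_algebraType A)).
  - exact: (@measurableI _ (g_sigma_algebraType B)).
  - move=> e me; have ma1 := sAm _ Aa1; have mb1 := sBm _ Bb1.
    rewrite -setIA H1; last exact: measurableI.
    rewrite [in LHS]setICA H2; last by apply: measurableI => //; exact: measurableI.
    congr (P _); apply/seteqP; split=> w /=; tauto.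
have subG : A `|` B `|` null_events `<=` G.
  move=> E0 [[AE|BE]|[mE PE]].
  - split; first exact: Am.
    exists E0, setT; split => //; first exact: sub_sigma_algebra.
    by move=> e _; rewrite setIT.
  - split; first exact: Bm.
    exists setT, E0; split => //; first exact: sub_sigma_algebra.
    by move=> e _; rewrite setTI.
  (* A null event is represented by the empty intersection. *)
  - split => //; exists set0, setT; split => //.
      exact: (@measurable0 _ (g_sigma_algebraType A)).
    move=> e me; rewrite !set0I measure0; apply/eqP.
    rewrite -measure_le0 -PE; apply: le_measure; rewrite ?inE//.
    exact: measurableI.
(* The two finite measures to be identified are E -> P(E and c) and E -> P(c) P(E). *)
pose m1 := mrestr P mc.
have Pc0 : 0 <= fine (P c) by rewrite fine_ge0.
pose m2 := mscale (NngNum Pc0) P.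
have m12 : m1 E = m2 E.
  apply: (g_sigma_algebra_measure_unique G _ (fun=> setT)) => //.
  - by move=> ? [].
  - by rewrite bigcup_const.
  - move=> E0 [mE0 [a [b [Aa Bb HE]]]].
    transitivity (P (E0 `&` c)) => //.
    transitivity ((fine (P c))%:E * P E0)%E => //.
    rewrite HE// H// muleC fineK ?fin_num_measure//.
    by have := HE _ measurableT; rewrite !setIT => ->.
  - move=> k; change (P (setT `&` c) < +oo)%E.
    by rewrite ltey_eq fin_num_measure//; exact: measurableI.
  - exact: sub_sigma_algebra2 sE.
transitivity (m1 E) => //.
transitivity ((fine (P c))%:E * P E)%E; first by rewrite m12.
by rewrite fineK ?fin_num_measure// muleC.
Qed.

End independence.

(** * Gaussian moments *)

Section normal_moments.
Context {R : realType}.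
Variables (s : R).
Hypothesis s0 : 0 < s.
Local Notation mu := (@lebesgue_measure R).
Local Notation phi := (normal_pdf 0 s).
Local Notation N := (normal_prob 0 s).

Let s0' : s != 0. Proof. by rewrite gt_eqF. Qed.

Lemma expr_le_expR (y : R) n : 0 <= y -> y ^+ n <= n`!%:R * expR y.
Proof.
move=> y0; case: n => [|n]; first by rewrite mul1r expr0 -expR0 ler_expR.
rewrite mulrC -ler_pdivrMr ?ltr0n ?fact_gt0//.
by apply: le_trans (expR_ge1Dxn n y0); rewrite lerDr.
Qed.

(** With y = x^2 / (4 s^2) the Gaussian exponent is -y - y. One factor exp(-y) absorbs y^p, as y^p
    <= p! exp(y); the other is a Gaussian of standard deviation sqrt 2 * s. *)
Lemma even_moment_pdf_le p : exists2 K, 0 <= K &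
  forall x, x ^+ p.*2 * phi x <= K * normal_pdf 0 (Num.sqrt 2 * s) x.
Proof.
have s2 : Num.sqrt 2 * s != 0 by rewrite mulf_neq0// gt_eqF// sqrtr_gt0.
have p1 : 0 < normal_peak s by exact: normal_peak_gt0.
have p2 : 0 < normal_peak (Num.sqrt 2 * s) by exact: normal_peak_gt0.
exists ((4 * s ^+ 2) ^+ p * p`!%:R * normal_peak s / normal_peak (Num.sqrt 2 * s)).
  apply: divr_ge0 (ltW p2); apply: mulr_ge0 (ltW p1); apply: mulr_ge0 => //.
  by rewrite exprn_ge0// mulr_ge0// sqr_ge0.
move=> x; rewrite !normal_pdfE// /normal_fun subr0.
pose y := x ^+ 2 / (4 * s ^+ 2).
have y0 : 0 <= y by rewrite divr_ge0 ?sqr_ge0// mulr_ge0 ?sqr_ge0.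
have -> : - x ^+ 2 / (s ^+ 2 *+ 2) = - y - y by rewrite /y; field.
have -> : - x ^+ 2 / ((Num.sqrt 2 * s) ^+ 2 *+ 2) = - y.
  by rewrite /y exprMn sqr_sqrtr//; field.
have -> : x ^+ p.*2 = (4 * s ^+ 2) ^+ p * y ^+ p.
  rewrite -exprMn /y -mul2n exprM; congr (_ ^+ p); field.
  exact: s0'.
rewrite expRD; set P := normal_peak _ in p1 *; set Q := normal_peak _ in p2 *.
have -> : (4 * s ^+ 2) ^+ p * p`!%:R * P / Q * (Q * expR (- y)) =
   (4 * s ^+ 2) ^+ p * P * expR (- y) * (p`!%:R * expR y * expR (- y)).
  by rewrite -(mulrA _ (expR y)) expRxMexpNx_1 mulr1; field; rewrite gt_eqF.
have -> : (4 * s ^+ 2) ^+ p * y ^+ p * (P * (expR (- y) * expR (- y))) =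
   (4 * s ^+ 2) ^+ p * P * expR (- y) * (y ^+ p * expR (- y)) by ring.
apply: ler_wpM2l.
  by rewrite !mulr_ge0 ?expR_ge0 ?(ltW p1)// exprn_ge0// mulr_ge0// sqr_ge0.
by rewrite ler_wpM2r ?expR_ge0// expr_le_expR.
Qed.

Lemma measurable_moment_pdf m : measurable_fun setT (fun x : R => x ^+ m * phi x).
Proof. by apply: measurable_funM => //; exact: measurable_normal_pdf. Qed.

Lemma integrable_moment_pdf m :
  mu.-integrable setT (EFin \o (fun x : R => x ^+ m * phi x)).
Proof.
have ev p : mu.-integrable setT (EFin \o (fun x : R => x ^+ p.*2 * phi x)).
  have [K K0 HK] := even_moment_pdf_le p.
  have := integrable_normal_pdf 0 (Num.sqrt 2 * s).
  move=> /(integrableZl measurableT K); apply: le_integrable => //.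
  - apply/measurable_EFinP. exact (measurable_moment_pdf _).
  - move=> x _ /=; have e : 0 <= x ^+ p.*2 by rewrite -muln2 exprM sqr_ge0.
    by rewrite lee_fin !ger0_norm ?mulr_ge0 ?normal_pdf_ge0.
have := integrableD measurableT (ev 0%N) (ev m).
apply: le_integrable => //; first by apply/measurable_EFinP; exact (measurable_moment_pdf _).
move=> x _ /=; rewrite lee_fin expr0 mul1r.
have e : 0 <= x ^+ m.*2 by rewrite -muln2 exprM sqr_ge0.
have -> : phi x + x ^+ m.*2 * phi x = (1 + x ^+ m.*2) * phi x by ring.
rewrite !normrM ler_wpM2r// (ger0_norm (addr_ge0 ler01 e)).
rewrite normrX -muln2 exprM -(real_normK (num_real (x ^+ m))) normrX.
by set z := `|x| ^+ m; have := sqr_ge0 (z - 1); have := sqr_ge0 z; rewrite sqrrB1; lra.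
Qed.


(** The product rule combined with phi' = -(x / s^2) phi. For [m = 0] the junk value [0.-1 = 0] is
    multiplied by 0. *)
Lemma is_derive_moment_pdf m (x : R) :
  is_derive x 1 (fun x => - s ^+ 2 * (x ^+ m * phi x))
    (x ^+ m.+1 * phi x - m%:R * s ^+ 2 * (x ^+ m.-1 * phi x)).
Proof.
rewrite normal_pdfE// /normal_fun.
have D1 : is_derive x 1 (fun x => - (x - 0) ^+ 2 / (s ^+ 2 *+ 2)) (- x / s ^+ 2).
  have -> : (fun x : R => - (x - 0) ^+ 2 / (s ^+ 2 *+ 2)) =
    (- (s ^+ 2 *+ 2)^-1) *: (fun x : R => x ^+ 2).
    by apply/funext => y; rewrite subr0 mulNr mulrC -mulNr.
  by apply: is_derive_eq; rewrite /GRing.scale/=; field.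
have D2 : is_derive x 1 (fun x => expR (- (x - 0) ^+ 2 / (s ^+ 2 *+ 2)))
    (expR (- (x - 0) ^+ 2 / (s ^+ 2 *+ 2)) * (- x / s ^+ 2)).
  exact: (is_derive1_comp (is_derive_expR _) D1).
have D3 : is_derive x 1 (fun x => x ^+ m) (m%:R * x ^+ m.-1).
  have := @is_deriveX R R^o id m x 1 1 (is_derive_id _ _).
  by rewrite /GRing.scale/= mulr1 exprfctE.
rewrite [X in is_derive _ _ X _](_ : _ = (- s ^+ 2 * normal_peak s) *:
  ((fun x : R => x ^+ m) * (fun x => expR (- (x - 0) ^+ 2 / (s ^+ 2 *+ 2))))).
2: by apply/funext => y; rewrite !fctE /GRing.scale/=; ring.
apply: is_derive_eq; rewrite /GRing.scale/= (exprS x m).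
by set e := expR _; field.
Qed.

Lemma continuous_moment_pdf m : continuous (fun x : R => x ^+ m * phi x).
Proof.
move=> x; apply: cvgM; first exact: exprn_continuous.
exact: continuous_normal_pdf.
Qed.

Let F m (x : R) := - s ^+ 2 * (x ^+ m * phi x).
Let f m (x : R) := x ^+ m.+1 * phi x - m%:R * s ^+ 2 * (x ^+ m.-1 * phi x).

Let F_continuous m : continuous (F m).
Proof.
move=> x; apply: cvgM; first exact: cvg_cst.
exact: continuous_moment_pdf.
Qed.

Let f_continuous m : continuous (f m).
Proof.
move=> x; apply: cvgB; first exact: continuous_moment_pdf.
apply: cvgM; first exact: cvg_cst.
exact: continuous_moment_pdf.
Qed.

Let f_integrable m : mu.-integrable setT (EFin \o f m).
Proof.
have := integrableZl measurableT (m%:R * s ^+ 2) (integrable_moment_pdf m.-1).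
exact: (integrableB measurableT (integrable_moment_pdf m.+1)).
Qed.

Let integral_f_itv m n : (\int[mu]_(x in `[(- n.+1%:R)%R, n.+1%:R]) (f m x)%:E =
  (F m n.+1%:R)%:E - (F m (- n.+1%:R))%:E)%E.
Proof.
apply: continuous_FTC2.
- by rewrite gtrN.
- exact/continuous_subspaceT/f_continuous.
- split.
  + by move=> x _; have [] := is_derive_moment_pdf m x.
  + by apply: cvg_at_right_filter; exact: F_continuous.
  + by apply: cvg_at_left_filter; exact: F_continuous.
- by move=> x _; rewrite derive1E; have [_ ->] := is_derive_moment_pdf m x.
Qed.

(** Controls the boundary terms of the integration by parts: for |x| >= 1, |x|^(m+1) is at most
    x^(2(m+1)), whose product with [phi] is bounded. *)
Let F_bound m : exists K, forall x, 1 <= `|x| -> `|F m x| <= K / `|x|.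
Proof.
have [K K0 HK] := even_moment_pdf_le m.+1.
have s2 : Num.sqrt 2 * s != 0 by rewrite mulf_neq0// gt_eqF// sqrtr_gt0.
exists (s ^+ 2 * (K * normal_peak (Num.sqrt 2 * s))) => x x1.
have x0 : 0 < `|x| by exact: lt_le_trans x1.
have -> : `|F m x| = s ^+ 2 * (`|x ^+ m| * phi x).
  rewrite /F mulNr normrN normrM (gtr0_norm (exprn_gt0 2 s0)) normrM.
  by rewrite (ger0_norm (normal_pdf_ge0 _ _ _)).
rewrite ler_pdivlMr// -mulrA ler_pM2l ?exprn_gt0//.
apply: (@le_trans _ _ (x ^+ m.+1.*2 * phi x)).
  rewrite mulrAC ler_wpM2r ?normal_pdf_ge0// normrX -exprSr.
  rewrite -[in leRHS]mul2n exprM -real_normK ?num_real// -exprM mul2n.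
  by rewrite ler_weXn2l// -addnn leq_addr.
by apply: (le_trans (HK x)); rewrite ler_wpM2l// normal_pdf_ub.
Qed.

Let cvg_integral_f_itv m :
  (\int[mu]_(x in `[(- n.+1%:R)%R, n.+1%:R]) (f m x)%:E)%E @[n --> \oo]
  --> (\int[mu]_x (f m x)%:E)%E.
Proof.
pose A n : set R := `[(- n.+1%:R)%R, n.+1%:R]%classic.
under eq_fun => n do rewrite integral_mkcond.
have /integrable_abse iaf := f_integrable m.
have mfm : measurable_fun setT (f m) by exact: continuous_measurable_fun.
pose g n : R -> \bar R := (EFin \o f m) \_ (A n).
have mg n : measurable_fun setT (g n).
  apply/(measurable_restrictT _ _).1 .
    exact: measurable_itv.
  by apply: measurable_funTS; exact/measurable_EFinP.
have gf : {ae mu, forall x, setT x -> g ^~ x @ \oo --> (EFin \o f m) x}.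
  apply: aeW => x _; apply: cvg_near_cst; near=> n.
  rewrite /g patchE mem_set// /A/= in_itv/= -ler_norml.
  near: n; exists (Num.truncn `|x|) => // n /= xn.
  by apply: ltW; apply: (lt_le_trans (truncnS_gt _)); rewrite ler_nat ltnS.
have gle : {ae mu, forall x n, setT x ->
    (`|g n x| <= (abse \o (EFin \o f m)) x)%E}.
  by apply: aeW => x n _ /=; rewrite /g patchE; case: ifP => // _; rewrite abse0.
have mf' : measurable_fun setT (EFin \o f m) by exact/measurable_EFinP.
by have [_ _] := @dominated_convergence _ _ _ mu setT measurableT g (EFin \o f m)
  (abse \o (EFin \o f m)) mg mf' gf iaf gle.
Unshelve. all: by end_near. Qed.

Let cvg_F_itv m (e : R) : `|e| = 1 -> F m (e * n.+1%:R) @[n --> \oo] --> (0 : R).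
Proof.
move=> e1; have [K HK] := F_bound m; apply/norm_cvg0P.
have K0 : K * n.+1%:R^-1 @[n --> \oo] --> (0 : R).
  rewrite -[X in _ --> X](mulr0 K); apply: cvgM; first exact: cvg_cst.
  exact: cvg_harmonic.
apply: (@squeeze_cvgr _ _ _ _ (fun=> 0) (fun n => K * n.+1%:R^-1)) => //; last exact: cvg_cst.
apply: nearW => n; rewrite normr_ge0/=.
have H : `|e * n.+1%:R| = n.+1%:R by rewrite normrM e1 mul1r normr_nat.
by rewrite -[in leRHS]H; apply: HK; rewrite H ler1n.
Qed.

(** Gaussian integration by parts: over growing symmetric intervals the integral of [f m] equals
    boundary terms of [F m] that vanish in the limit, while dominated convergence gives the integral
    over the line. *)
Lemma integral_moment_pdf_rec m :
  \int[mu]_x (x ^+ m.+1 * phi x) = m%:R * s ^+ 2 * \int[mu]_x (x ^+ m.-1 * phi x).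
Proof.
apply/eqP; rewrite -subr_eq0 -RintegralZl//; last exact: integrable_moment_pdf.
rewrite -RintegralB//; last 2 first.
- exact: integrable_moment_pdf.
- exact: (integrableZl measurableT _ (integrable_moment_pdf m.-1)).
apply/eqP; rewrite /Rintegral -[RHS]/(fine 0%E); congr fine.
have H := cvg_integral_f_itv (m := m).
rewrite -(cvg_lim _ H)//; apply: cvg_lim => //.
have Fp : F m n.+1%:R @[n --> \oo] --> (0 : R).
  have := @cvg_F_itv m 1 (normr1 _).
  by have -> : (fun n => F m (1 * n.+1%:R)) = fun n => F m n.+1%:R;
    [apply/funext => n; rewrite mul1r|].
have Fm : F m (- n.+1%:R) @[n --> \oo] --> (0 : R).
  have := @cvg_F_itv m (-1) (normrN1 _).
  by have -> : (fun n => F m (-1 * n.+1%:R)) = fun n => F m (- n.+1%:R);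
    [apply/funext => n; rewrite mulN1r|].
have -> : (fun n => (\int[mu]_(x in `[(- n.+1%:R)%R, n.+1%:R]) (f m x)%:E)%E) =
    fun n => (F m n.+1%:R - F m (- n.+1%:R))%:E.
  by apply/funext => n; rewrite integral_f_itv.
apply: cvg_EFin; first exact: nearW.
by rewrite -[X in _ --> X](subrr 0); exact: cvgB.
Qed.

Lemma Rintegral_moment_pdf m :
  \int[mu]_x (x ^+ m * phi x) = s ^+ m * (gaussian_moment m)%:R.
Proof.
have [n] := ubnP m; elim: n m => // n IH [_|[_|m mn]].
- rewrite expr0 mul1r /Rintegral.
  by under eq_integral do rewrite expr0 mul1r; rewrite integral_normal_pdf.
- by rewrite integral_moment_pdf_rec mulr0n !mul0r mulr0.
- rewrite integral_moment_pdf_rec succnK IH; last by lia.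
  by rewrite /= natrM !exprS expr0; ring.
Qed.

End normal_moments.

Section normal_expectation.
Context {R : realType}.
Variables (s : R).
Hypothesis s0 : 0 < s.
Local Notation mu := (@lebesgue_measure R).
Local Notation phi := (normal_pdf 0 s).
Local Notation N := (normal_prob 0 s).

(** The Radon-Nikodym derivative of the normal law coincides with the density almost everywhere,
    because both have the same integrals over measurable sets. *)
Lemma integral_normal_prob (f : R -> R) U : measurable U ->
  N.-integrable U (EFin \o f) ->
  (\int[N]_(x in U) (f x)%:E = \int[mu]_(x in U) (f x * phi x)%:E)%E.
Proof.
move=> mU intf; have mf : measurable_fun U (EFin \o f) by case/integrableP : intf.
transitivity (\int[mu]_(x in U) ((EFin \o f) x * (phi x)%:E))%E => //.
rewrite -(Radon_Nikodym_change_of_variables (normal_prob_dominates 0 s) mU intf)//=.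
apply: ae_eq_integral => //.
- apply: emeasurable_funM => //; apply: (measurable_int mu).
  apply: (integrableS _ _ (@subsetT _ _)) => //=.
  by apply: Radon_Nikodym_integrable; exact: normal_prob_dominates.
- apply: emeasurable_funM => //=; apply/measurableT_comp => //=.
  by apply/measurable_funTS; exact: measurable_normal_pdf.
- apply: ae_eqe_mul2l => /=.
  rewrite Radon_NikodymE//=; first exact: normal_prob_dominates.
  move=> dom; case: cid => /= h [h1 h2 h3].
  apply: integral_ae_eq => //=.
  + exact: integrableS h2.
  + apply/measurable_funTS/measurableT_comp => //; exact: measurable_normal_pdf.
  + by move=> E E01 mE; rewrite -h3.
Qed.

(** Passing to the density presupposes integrability under [N], so it is done on bounded sets, where
    integrability is plain; the truncations are then removed. *)
Lemma has_moments_normal : has_moments N id.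
Proof.
apply: has_moments_even => // p.
pose A M : set R := [set x | `|x| <= M%:R].
have mA M : measurable (A M).
  have := measurable_itv `[(- M%:R : R), M%:R]; congr measurable.
  by apply/seteqP; split => x /=; rewrite in_itv/= -ler_norml.
apply: (@integrable_of_truncations _ _ _ N A (fun x : R => x ^+ p.*2)
  (\int[mu]_x (x ^+ p.*2 * phi x))) => //.
- move=> m n mn; apply/subsetPset => w; rewrite /A/= => /le_trans; apply.
  by rewrite ler_nat.
- rewrite -subTset => w _; exists (Num.truncn `|w|).+1 => //=.
  by rewrite /A/= ltW// truncnS_gt.
- by move=> x; rewrite -muln2 exprM sqr_ge0.
move=> M; rewrite integral_normal_prob; [|exact: (mA M)|].
2: {
  have := finite_measure_integrable_cst N (M%:R ^+ p.*2) (mA M).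
  apply: le_integrable.
  - exact (mA M).
  - have mX : measurable_fun (A M) (fun x : R => x ^+ p.*2) by exact: measurable_funX.
    exact ((measurable_EFinP _ _).2 mX).
  - move=> x /= xM; rewrite lee_fin normrX [leRHS]ger0_norm ?exprn_ge0//.
    by apply: lerXn2r; rewrite ?nnegrE.
}
rewrite /Rintegral fineK; last first.
  by apply: integrable_fin_num => //; exact: integrable_moment_pdf.
apply: ge0_subset_integral => //.
- exact (mA M).
- exact ((measurable_EFinP _ _).2 (measurable_moment_pdf _ _)).
- by move=> x _; rewrite lee_fin mulr_ge0 ?normal_pdf_ge0// -muln2 exprM sqr_ge0.
Qed.

Lemma mean_normalX m : mean N (fun x => x ^+ m) = s ^+ m * (gaussian_moment m)%:R.
Proof.
rewrite -Rintegral_moment_pdf// /mean /Rintegral integral_normal_prob//.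
exact: has_moments_normal.
Qed.

Lemma normal_variable_moments d (T : measurableType d) (P : probability T R)
    (X : T -> R) : measurable_fun setT X ->
  (forall B, measurable B -> P (X @^-1` B) = N B) ->
  has_moments P X /\
  forall m, mean P (fun w => X w ^+ m) = s ^+ m * (gaussian_moment m)%:R.
Proof.
move=> mX XN.
pose X' : {mfun T >-> measurableTypeR R} :=
  HB.pack X (isMeasurableFun.Build _ _ T (measurableTypeR R) X mX).
have HX : has_moments P X.
  move=> m; apply/integrableP; split.
    by apply/measurable_EFinP; exact: measurable_funX.
  have /integrableP[_] := has_moments_normal m.
  suff -> : (\int[P]_w `|(EFin \o (fun w => X w ^+ m)%R) w| =
    \int[N]_x `|(EFin \o (fun x => x ^+ m)%R) x|)%E by [].
  transitivity (\int[distribution P X']_x `|(x ^+ m)%:E|)%E.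
    rewrite ge0_integral_distribution//.
    by apply: measurableT_comp => //; apply: measurableT_comp => //; exact: measurable_funX.
  refine (@eq_measure_integral _ (measurableTypeR R) R setT N (distribution P X') _ _).
  by move=> A mA _; exact: XN.
split => // m; rewrite -mean_normalX /mean /Rintegral; congr fine.
transitivity (\int[distribution P X']_x (x ^+ m)%:E)%E.
  rewrite (@integral_distribution _ _ _ _ _ P X' (fun x => (x ^+ m)%:E))//.
  - by apply/measurable_EFinP; exact: measurable_funX.
  - exact: HX.
refine (@eq_measure_integral _ (measurableTypeR R) R setT N (distribution P X') _ _).
by move=> A mA _; exact: XN.
Qed.

End normal_expectation.

(** * Wiener processes *)

Section wiener_increments.
Context d (T : measurableType d) (R : realType) (P : probability T R).
Implicit Types (V W : R -> {RV P >-> R}).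

Lemma events_of_measurable W (D : set R) :
  events_of (fun s => W s : T -> R) D `<=` measurable.
Proof.
by move=> _ [r _ [B mB <-]]; apply: (measurable_funP (W r)).
Qed.

Lemma adapted_events_of W (D : set R) r : D r ->
  adapted (events_of (fun s => W s : T -> R) D) (W r).
Proof. by move=> Dr A HA; apply: sub_sigma_algebra; exists r. Qed.

Lemma events_of_sub W (D D' : set R) : D `<=` D' ->
  events_of (fun s => W s : T -> R) D `<=` events_of (fun s => W s : T -> R) D'.
Proof. by move=> DD A [r Dr HA]; exists r => //; exact: DD. Qed.

(* W1 is observed until time r and W2 until time s. Two clocks are needed because
   simultaneous increments of W1 and W2 must be split off one after the other. *)
Definition bifiltration (W1 W2 : R -> {RV P >-> R}) (r s : R) : set_system T :=
  events_of W1 `[0, r] `|` events_of W2 `[0, s] `|` null_events P.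

Lemma bifiltrationC W1 W2 r s : bifiltration W1 W2 r s = bifiltration W2 W1 s r.
Proof. by rewrite /bifiltration (setUC (events_of W1 _)). Qed.

Lemma bifiltration_measurable W1 W2 r s : bifiltration W1 W2 r s `<=` measurable.
Proof.
by move=> A [[|]|[]]//; exact: events_of_measurable.
Qed.

Lemma bifiltration_sub W1 W2 r s r' s' : r <= r' -> s <= s' ->
  bifiltration W1 W2 r s `<=` bifiltration W1 W2 r' s'.
Proof.
move=> rr ss; apply: setSU; apply: setUSS; apply: events_of_sub;
  by move=> x /=; rewrite !in_itv/= => /andP[-> /le_trans]; apply.
Qed.

Lemma adapted_bifiltration1 W1 W2 q r s : 0 <= q <= r ->
  adapted (bifiltration W1 W2 r s) (W1 q).
Proof.
move=> qr; apply: (@adapted_sub _ _ _ (events_of W1 `[0, r])).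
  by move=> A HA; left; left.
by apply: adapted_events_of; rewrite /= in_itv.
Qed.

Lemma adapted_bifiltration2 W1 W2 q r s : 0 <= q <= s ->
  adapted (bifiltration W1 W2 r s) (W2 q).
Proof. by move=> qs; rewrite bifiltrationC; exact: adapted_bifiltration1. Qed.

Lemma independent_processesC W1 W2 :
  independent_processes W1 W2 -> independent_processes W2 W1.
Proof. by move=> H A B HA HB; rewrite setIC muleC; exact: H. Qed.

(** On generators, P(a b c) = P(a) P(b c) = P(a) P(b) P(c) = P(a b) P(c), by independence of the
    processes, then of the increment from the past of [W2], then of the processes again. The clock
    [r] is unrelated to [s] and [u], so [W1] may already be known at the end of the step. *)
Lemma increment_independent2 W1 W2 r s u :
  wiener_process W2 -> independent_processes W1 W2 -> 0 <= s -> s < u ->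
  independent P <<s bifiltration W1 W2 r s>> (sigma_rv (fun w => W2 u w - W2 s w)).
Proof.
move=> [_ _ W2i _] W12 s0 su; apply: independent_join.
- exact: events_of_measurable.
- exact: events_of_measurable.
- by move=> _ [B mB <-]; apply: measurable_funB.
move=> a b c Aa Bb Cc.
have Wsub D : D `<=` `[0, +oo[%classic -> forall V : R -> {RV P >-> R},
    <<s events_of V D>> `<=` <<s events_of V `[0, +oo[ >>.
  by move=> DD V; apply: sub_sigma_algebra2; exact: events_of_sub.
have D0 (v : R) : `[0, v]%classic `<=` `[0, +oo[%classic.
  by move=> x /=; rewrite !in_itv/= andbT => /andP[].
have a' := Wsub _ (@D0 r) W1 _ Aa.
have b' := Wsub _ (@D0 s) W2 _ Bb.
have c' : <<s events_of W2 `[0, +oo[ >> c.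
  have H : adapted (events_of W2 `[0, +oo[) (fun w => W2 u w - W2 s w).
    by apply: adaptedB; apply: adapted_events_of; rewrite /= in_itv/= andbT// ltW// (le_lt_trans s0).
  exact: H.
have bc : <<s events_of W2 `[0, +oo[ >> (b `&` c).
  exact: (@measurableI _ (g_sigma_algebraType (events_of W2 `[0, +oo[))).
rewrite -setIA (W12 _ _ a' bc) (W2i _ _ s0 su _ _ Bb Cc) (W12 _ _ a' b').
by rewrite muleA.
Qed.

Lemma increment_independent1 W1 W2 r s u :
  wiener_process W1 -> independent_processes W1 W2 -> 0 <= r -> r < u ->
  independent P <<s bifiltration W1 W2 r s>> (sigma_rv (fun w => W1 u w - W1 r w)).
Proof.
move=> hW1 /independent_processesC W21; rewrite bifiltrationC.
exact: increment_independent2.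
Qed.

Lemma increment_moments W s u : wiener_process W -> 0 <= s -> s <= u ->
  has_moments P (fun w => W u w - W s w) /\
  forall m, mean P (fun w => (W u w - W s w) ^+ m)
    = Num.sqrt (u - s) ^+ m * (gaussian_moment m)%:R.
Proof.
move=> [_ _ _ Wn] s0; rewrite le_eqVlt => /predU1P[<-|su].
  have E m : (fun w => (W s w - W s w) ^+ m) = fun=> 0 ^+ m.
    by apply/funext => w; rewrite subrr.
  split=> m; rewrite E; first exact: integrable_rv_cst.
  rewrite mean_cst subrr sqrtr0; case: m => [|m]; rewrite ?mulr1//.
  by rewrite exprS !mul0r.
apply: normal_variable_moments.
- by rewrite sqrtr_gt0 subr_gt0.
- exact: measurable_funB.
- by move=> B mB; exact: Wn.
Qed.

(* [G s] only generates the sigma-algebra of the events known at time [s]. *)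
Definition wiener_wrt (G : R -> set_system T) (W : R -> T -> R) :=
  [/\ forall s, G s `<=` measurable,
      forall s u, s <= u -> G s `<=` G u,
      forall s u, 0 <= s -> s <= u -> adapted (G u) (W s),
      (forall s u, 0 <= s -> s < u ->
         independent P <<s G s>> (sigma_rv (fun w => W u w - W s w))) &
      (forall s u, 0 <= s -> s <= u ->
         has_moments P (fun w => W u w - W s w) /\
         forall m, mean P (fun w => (W u w - W s w) ^+ m)
           = Num.sqrt (u - s) ^+ m * (gaussian_moment m)%:R)].

Lemma wiener_wrt1 W1 W2 : wiener_process W1 -> independent_processes W1 W2 ->
  wiener_wrt (fun s => bifiltration W1 W2 s s) W1.
Proof.
move=> hW1 W12; split.
- by move=> s; exact: bifiltration_measurable.
- by move=> s u su; exact: bifiltration_sub.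
- by move=> s u s0 su; apply: adapted_bifiltration1; rewrite s0.
- by move=> s u; exact: increment_independent1.
- by move=> s u; exact: increment_moments.
Qed.

Lemma wiener_wrt2 W1 W2 : wiener_process W2 -> independent_processes W1 W2 ->
  wiener_wrt (fun s => bifiltration W1 W2 s s) W2.
Proof.
move=> hW2 /independent_processesC W21.
have -> : (fun s => bifiltration W1 W2 s s) = fun s => bifiltration W2 W1 s s.
  by apply/funext => s; rewrite bifiltrationC.
exact: wiener_wrt1.
Qed.

End wiener_increments.

(** * Orthogonality of increments weighted by the past *)

Section martingale.
Context d (T : measurableType d) (R : realType) (P : probability T R).
Variables (G : R -> set_system T) (W : R -> T -> R).
Hypothesis WG : wiener_wrt P G W.
Local Notation mean := (mean P).
Local Notation integrable_rv := (integrable_rv P).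
Local Notation square_integrable := (square_integrable P).
Implicit Types (X Y : T -> R) (a b : R).

Let D a b w := W b w - W a w.

Lemma adapted_increment a b s : 0 <= a -> a <= b -> b <= s -> adapted (G s) (D a b).
Proof.
case: WG => _ _ WA _ _ a0 ab bs; apply: adaptedB; apply: WA => //.
  exact: le_trans ab.
exact: le_trans bs.
Qed.

Lemma adapted_le X a b : a <= b -> adapted (G a) X -> adapted (G b) X.
Proof. by case: WG => _ H _ _ _ /H; exact: adapted_sub. Qed.

Lemma increment_has_moments a b : 0 <= a -> a <= b -> has_moments P (D a b).
Proof. by case: WG => _ _ _ _ H a0 /(H _ _ a0)[]. Qed.

Lemma mean_adaptedM_incrementX X a b m : 0 <= a -> a <= b ->
  adapted (G a) X -> integrable_rv X ->
  integrable_rv (fun w => X w * D a b w ^+ m) /\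
  mean (fun w => X w * D a b w ^+ m) =
    mean X * (Num.sqrt (b - a) ^+ m * (gaussian_moment m)%:R).
Proof.
case: WG => Gm _ _ WI WM a0 ab GX iX; have [hD <-] := WM _ _ a0 ab.
move: ab; rewrite le_eqVlt => /predU1P[ab|ab].
  have -> : (fun w => X w * D a b w ^+ m) = (fun w => 0 ^+ m * X w).
    by apply/funext => w; rewrite /D -ab subrr mulrC.
  have -> : (fun w => (W b w - W a w) ^+ m) = (fun=> 0 ^+ m).
    by apply/funext => w; rewrite -ab subrr.
  by rewrite mean_cst meanZ// mulrC; split => //; exact: integrable_rvZ.
apply: (independent_meanM _ iX (hD m)).
apply: independent_sub GX _ (WI _ _ a0 ab).
by apply: (@sigma_rv_comp _ _ _ (fun w => W b w - W a w) (fun x => x ^+ m)); exact: measurable_funX.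
Qed.

Lemma mean_adaptedM_increment X a b : 0 <= a -> a <= b ->
  adapted (G a) X -> integrable_rv X ->
  integrable_rv (fun w => X w * D a b w) /\ mean (fun w => X w * D a b w) = 0.
Proof.
move=> a0 ab GX iX; have := mean_adaptedM_incrementX 1 a0 ab GX iX.
by under eq_fun do rewrite expr1; rewrite /= !mulr0n !mulr0.
Qed.

Lemma mean_adaptedM_increment2 X a b : 0 <= a -> a <= b ->
  adapted (G a) X -> integrable_rv X ->
  integrable_rv (fun w => X w * D a b w ^+ 2) /\
  mean (fun w => X w * D a b w ^+ 2) = mean X * (b - a).
Proof.
move=> a0 ab GX iX; have := mean_adaptedM_incrementX 2 a0 ab GX iX.
by rewrite sqr_sqrtr ?subr_ge0//= mulr1.
Qed.

Lemma square_integrableM_increment X a b : 0 <= a -> a <= b ->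
  adapted (G a) X -> square_integrable X ->
  square_integrable (fun w => X w * D a b w).
Proof.
move=> a0 ab GX sX; split.
  apply: measurable_funM sX.1 _.
  exact: has_moments_measurable (increment_has_moments a0 ab).
under eq_fun do rewrite exprMn.
have := mean_adaptedM_increment2 a0 ab _ sX.2.
by move=> H; apply: (H _).1; exact: adaptedX.
Qed.

(** The length of the intersection of []a, b]] and []a', b']]. *)
Definition overlap a b a' b' : R :=
  Num.max 0 (Num.min b b' - Num.max a a').

(** The polarized isometry for one pair of steps. For a <= a' both increments are cut at a' and at
    the smaller right end; only the square of the common increment has nonzero mean, as every other
    product ends with an increment independent of the rest. *)
Lemma mean_increment_prod X Y a b a' b' :
  0 <= a -> a <= b -> 0 <= a' -> a' <= b' ->
  adapted (G a) X -> square_integrable X ->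
  adapted (G a') Y -> square_integrable Y ->
  mean (fun w => (X w * D a b w) * (Y w * D a' b' w)) =
  mean (fun w => X w * Y w) * overlap a b a' b'.
Proof.
wlog aa : X Y a b a' b' / a <= a'.
  move=> H a0 ab a0' ab' GX sX GY sY; have [aa|/ltW aa] := leP a a'.
    exact: (H X Y a b a' b' aa a0 ab a0' ab' GX sX GY sY).
  have := H Y X a' b' a b aa a0' ab' a0 ab GY sY GX sX.
  rewrite /overlap (minC b') (maxC a') => H'.
  transitivity (mean (fun w => Y w * D a' b' w * (X w * D a b w))).
    by congr mean; apply/funext => w; rewrite mulrC.
  rewrite H' (_ : (fun w => Y w * X w) = fun w => X w * Y w)//.
  by apply/funext => w; rewrite mulrC.
move=> a0 ab a0' ab' GX sX GY sY; rewrite /overlap (max_idPr aa).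
have GX' : adapted (G a') X by exact: adapted_le GX.
have iXY := square_integrableM sX sY.
have sXD := square_integrableM_increment a0 ab GX sX.
have [ba|ab2] := leP b a'.
  have -> : Num.max 0 (Num.min b b' - a') = 0.
    by apply/max_idPl; rewrite subr_le0 ge_min ba.
  rewrite mulr0.
  have -> : (fun w => X w * D a b w * (Y w * D a' b' w)) =
      fun w => X w * D a b w * Y w * D a' b' w.
    by apply/funext => w; rewrite mulrA.
  apply: (mean_adaptedM_increment a0' ab' _ _).2.
    by do 2 (apply: adaptedM => //); exact: adapted_increment.
  exact: square_integrableM.
(* Taking [c] and [e] as the smaller and the larger right end treats both orders of [b] and [b'] by
   the same three products. *)
pose c := Num.min b b'; pose e := Num.max b b'.
have ac : a' <= c by rewrite /c le_min ab' ltW.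
have ce : c <= e by rewrite /c /e ge_min le_max lexx.
have -> : Num.max 0 (Num.min b b' - a') = c - a' by apply/max_idPr; rewrite subr_ge0.
have iXYr : adapted (G a') (fun w => X w * Y w) by exact: adaptedM.
have sXDa := square_integrableM_increment a0 aa GX sX.
have [i1 m1] : integrable_rv (fun w => (X w * D a a' w * Y w) * D a' b' w) /\
    mean (fun w => (X w * D a a' w * Y w) * D a' b' w) = 0.
  apply: mean_adaptedM_increment => //; last exact: square_integrableM.
  by do 2 (apply: adaptedM => //); exact: adapted_increment.
have [i2 m2] := mean_adaptedM_increment2 a0' ac iXYr iXY.
have [i3 m3] : integrable_rv (fun w => (X w * Y w * D a' c w) * D c e w) /\
    mean (fun w => (X w * Y w * D a' c w) * D c e w) = 0.
  apply: mean_adaptedM_increment => //.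
  - exact: le_trans ac.
  - by apply: adaptedM; [exact: adapted_le iXYr|exact: adapted_increment].
  - by have [] := mean_adaptedM_increment a0' ac iXYr iXY.
rewrite -m2 -[RHS]add0r -m1 -[RHS]addr0 -m3 -meanD// -meanD//; last first.
  exact: integrable_rvD.
congr (mean _); apply/funext => w; rewrite /D /c /e.
by have [bb|bb] := leP b b'; ring.
Qed.

End martingale.

(** * The Ito isometry *)

Section double_integral.
Context d (T : measurableType d) (R : realType) (P : probability T R).
Variables (alpha beta : R).
Local Notation mu := (@lebesgue_measure R).
Implicit Types u v : R -> T -> R.

Definition double_integral u : \bar R :=
  (\int[P]_w \int[mu]_(s in `[alpha, beta]) (u s w)%:E)%E.

Definition jointly_measurable u :=
  measurable_fun (`[alpha, beta] `*` [set: T]) (fun z : R * T => u z.1 z.2).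

(** Extension by 0 outside the strip, since Tonelli's theorem is applied on the whole product
    space. *)
Let patched u : R * T -> \bar R :=
  (fun z => (u z.1 z.2)%:E) \_ (`[alpha, beta] `*` [set: T]).

Let measurable_patched u : jointly_measurable u ->
  measurable_fun [set: R * T] (patched u).
Proof.
move=> mu'; apply/(measurable_restrictT _ _).1.
  by apply: measurableX => //; exact: measurable_itv.
exact/measurable_EFinP.
Qed.

Let patched_ge0 u : (forall s w, 0 <= u s w) -> forall z, (0 <= patched u z)%E.
Proof. by move=> u0 z; rewrite /patched patchE; case: ifP => // _; rewrite lee_fin. Qed.

Let patchedE u w : (\int[mu]_(s in `[alpha, beta]) (u s w)%:E =
  \int[mu]_s patched u (s, w))%E.
Proof.
rewrite integral_mkcond; apply: eq_integral => s _.
rewrite /patched !patchE; congr (if _ then _ else _).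
by apply/idP/idP; rewrite !inE => // -[].
Qed.

Lemma measurable_section u w : jointly_measurable u ->
  measurable_fun `[alpha, beta] (fun s => (u s w)%:E).
Proof.
move=> /measurable_patched mp; apply/(measurable_restrictT _ _).2.
  exact: measurable_itv.
have -> : (fun s => (u s w)%:E) \_ `[alpha, beta] = (patched u) \o (fun s => (s, w)).
  apply/funext => s; rewrite /patched/= !patchE; congr (if _ then _ else _).
  by apply/idP/idP; rewrite !inE => // -[].
by apply: measurableT_comp => //; exact: pair2_measurable.
Qed.

Lemma measurable_inner_integral u : jointly_measurable u ->
  (forall s w, 0 <= u s w) ->
  measurable_fun setT (fun w => (\int[mu]_(s in `[alpha, beta]) (u s w)%:E)%E).
Proof.
move=> mu' u0; under eq_fun do rewrite patchedE.
by apply: (@measurable_fun_fubini_tonelli_G _ _ _ _ _ mu) => //;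
  [exact: measurable_patched|exact: patched_ge0].
Qed.

Lemma measurable_outer_integral u : jointly_measurable u ->
  (forall s w, 0 <= u s w) ->
  measurable_fun `[alpha, beta] (fun s => (\int[P]_w (u s w)%:E)%E).
Proof.
move=> mu' u0; apply/(measurable_restrictT _ _).2; first exact: measurable_itv.
have -> : (fun s => (\int[P]_w (u s w)%:E)%E) \_ `[alpha, beta] =
    fun s => (\int[P]_w patched u (s, w))%E.
  apply/funext => s; rewrite patchE /patched; case: ifPn => sI.
    by apply: eq_integral => w _; rewrite patchE mem_set//; split => //; exact: set_mem.
  rewrite integral0_eq// => w _; rewrite patchE memNset// => -[/= + _].
  by move/mem_set; apply/negP.
by apply: (@measurable_fun_fubini_tonelli_F _ _ _ _ _ P) => //;
  [exact: measurable_patched|exact: patched_ge0].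
Qed.

Lemma double_integral_swap u : jointly_measurable u -> (forall s w, 0 <= u s w) ->
  double_integral u = (\int[mu]_(s in `[alpha, beta]) \int[P]_w (u s w)%:E)%E.
Proof.
move=> mu' u0; rewrite /double_integral.
under eq_integral do rewrite patchedE.
have := @fubini_tonelli _ _ _ _ _ mu P (patched u) (measurable_patched mu')
  (patched_ge0 u0).
rewrite /fubini_F /fubini_G/= => <-.
rewrite [RHS]integral_mkcond; apply: eq_integral => s _.
rewrite patchE /patched; case: ifPn => sI.
  by apply: eq_integral => w _; rewrite patchE mem_set//; split => //; exact: set_mem.
rewrite integral0_eq// => w _; rewrite patchE memNset// => -[/= + _].
by move/mem_set; apply/negP.
Qed.

Lemma double_integral_le u v : jointly_measurable u -> jointly_measurable v ->
  (forall s w, 0 <= u s w) -> (forall s w, u s w <= v s w) ->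
  (double_integral u <= double_integral v)%E.
Proof.
move=> mu' mv u0 uv.
have v0 s w : 0 <= v s w by exact: le_trans (uv s w).
apply: ge0_le_integral => //.
- by move=> w _; apply: integral_ge0 => s _; rewrite lee_fin.
- exact: measurable_inner_integral.
- exact: measurable_inner_integral.
- move=> w _; apply: ge0_le_integral => //.
  + by move=> s _; rewrite lee_fin.
  + exact: measurable_section.
  + exact: measurable_section.
  + by move=> s _; rewrite lee_fin.
Qed.

Lemma double_integralD u v : jointly_measurable u -> jointly_measurable v ->
  (forall s w, 0 <= u s w) -> (forall s w, 0 <= v s w) ->
  double_integral (fun s w => u s w + v s w) =
  (double_integral u + double_integral v)%E.
Proof.
move=> mu' mv u0 v0; rewrite /double_integral -ge0_integralD//.
- apply: eq_integral => w _; rewrite -ge0_integralD//.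
  + by move=> s _; rewrite lee_fin.
  + exact: measurable_section.
  + by move=> s _; rewrite lee_fin.
  + exact: measurable_section.
- by move=> w _; apply: integral_ge0 => s _; rewrite lee_fin.
- exact: measurable_inner_integral.
- by move=> w _; apply: integral_ge0 => s _; rewrite lee_fin.
- exact: measurable_inner_integral.
Qed.

Lemma double_integralZ c u : 0 <= c -> jointly_measurable u ->
  (forall s w, 0 <= u s w) ->
  double_integral (fun s w => c * u s w) = (c%:E * double_integral u)%E.
Proof.
move=> c0 mu' u0; rewrite /double_integral -ge0_integralZl//; last 2 first.
- exact: measurable_inner_integral.
- by move=> w _; apply: integral_ge0 => s _; rewrite lee_fin.
apply: eq_integral => w _; rewrite -ge0_integralZl//.
- exact: measurable_section.
- by move=> s _; rewrite lee_fin.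
Qed.

Lemma jointly_measurable_sqrB u v : jointly_measurable u -> jointly_measurable v ->
  jointly_measurable (fun s w => (u s w - v s w) ^+ 2).
Proof. by move=> mu' mv; apply: measurable_funX; exact: measurable_funB. Qed.

Lemma double_integral_sqrB_le u v w : jointly_measurable u ->
  jointly_measurable v -> jointly_measurable w ->
  (double_integral (fun s x => (u s x - w s x) ^+ 2)%R <=
   2%:E * double_integral (fun s x => (v s x - u s x) ^+ 2)%R +
   2%:E * double_integral (fun s x => (v s x - w s x) ^+ 2)%R)%E.
Proof.
move=> mu' mv mw.
have h1 := jointly_measurable_sqrB mv mu'; have h2 := jointly_measurable_sqrB mv mw.
have h1' : jointly_measurable (fun s x => 2 * (v s x - u s x) ^+ 2).
  exact: measurable_funM.
have h2' : jointly_measurable (fun s x => 2 * (v s x - w s x) ^+ 2).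
  exact: measurable_funM.
rewrite -!double_integralZ//; try by move=> *; exact: sqr_ge0.
rewrite -double_integralD//; try by move=> *; rewrite mulr_ge0// sqr_ge0.
apply: double_integral_le.
- exact: jointly_measurable_sqrB.
- exact: measurable_funD.
- by move=> *; exact: sqr_ge0.
- move=> s x; have := sqrD_le (u s x - v s x)%R (v s x - w s x)%R.
  by rewrite subrKA -(sqrrN (u s x - v s x)%R) opprB.
Qed.

End double_integral.

Section ito_isometry.
Context d (T : measurableType d) (R : realType) (P : probability T R).
Variables (G : R -> set_system T) (W : R -> T -> R).
Hypothesis WG : wiener_wrt P G W.
Local Notation mean := (mean P).
Local Notation integrable_rv := (integrable_rv P).
Local Notation square_integrable := (square_integrable P).
Local Notation mu := (@lebesgue_measure R).

Section step_processes.
Variables (alpha beta : R).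
Hypothesis alpha0 : 0 <= alpha.

Lemma integral_overlap (a b a' b' : R) :
  alpha <= a -> b <= beta -> alpha <= a' -> b' <= beta ->
  mu.-integrable `[alpha, beta]
    (EFin \o (fun s : R => \1_(`]a, b]) s * \1_(`]a', b']) s)) /\
  (\int[mu]_(s in `[alpha, beta]) (\1_(`]a, b]) s * \1_(`]a', b']) s)%:E =
   (overlap a b a' b')%:E)%E.
Proof.
move=> aa bb aa' bb'.
have E : (fun s : R => \1_(`]a, b]) s * \1_(`]a', b']) s) =
    \1_(`]Num.max a a', Num.min b b']) :> (R -> R).
  apply/funext => s; rewrite !indicE -natrM mulnb; congr (nat_of_bool _)%:R.
  apply/idP/idP.
    rewrite -!/(is_true _) => /andP[]; rewrite !inE /= !in_itv/= gt_max le_min.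
    by move=> /andP[-> ->] /andP[-> ->].
  rewrite inE /= in_itv/= gt_max le_min => /andP[/andP[h1 h2] /andP[h3 h4]].
  by rewrite !mem_set//= in_itv/= ?h1 ?h2.
have sub : `]Num.max a a', Num.min b b']%classic `<=` `[alpha, beta]%classic.
  move=> s /=; rewrite !in_itv/= gt_max le_min => /andP[/andP[h1 h2] /andP[h3 h4]].
  by rewrite (le_trans aa (ltW h1)) (le_trans h3 bb).
split.
  rewrite E; apply: (integrableS measurableT) => //.
  exact: integrable_indic_itv.
under eq_integral => s _ do rewrite [X in X%:E](congr1 (fun f => f s) E).
rewrite integral_indic//= (setIidl sub) lebesgue_measure_itv/= lte_fin /overlap.
set u := Num.max a a'; set v := Num.min b b'; case: ltP => uv.
  by have /max_idPr -> : 0 <= v - u by rewrite subr_ge0 ltW.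
by have /max_idPl -> : v - u <= 0 by rewrite subr_le0.
Qed.

Section one_process.
Variables (I : finType) (xi : I -> T -> R) (a b : I -> R).

(** Any finite index type and overlapping intervals are allowed, so that the difference of two step
    processes is a step process over [I + J], without a common refinement of the partitions. *)
Definition step_fun s w : R := \sum_i xi i w * \1_(`]a i, b i]) s.

Definition step_integral w : R := \sum_i xi i w * (W (b i) w - W (a i) w).

Definition adapted_steps := forall i, [/\ alpha <= a i, a i <= b i, b i <= beta,
  adapted (G (a i)) (xi i) & square_integrable (xi i)].

Hypothesis adx : adapted_steps.

Let sI i : square_integrable (fun w => xi i w * (W (b i) w - W (a i) w)).
Proof.
have [h1 h2 h3 h4 h5] := adx i.
by apply: (square_integrableM_increment WG) => //; exact: le_trans h1.
Qed.

Lemma square_integrable_step_integral : square_integrable step_integral.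
Proof. exact: square_integrable_sum. Qed.

Let ipair i j : integrable_rv (fun w => xi i w * xi j w).
Proof. by have [_ _ _ _ h1] := adx i; have [_ _ _ _ h2] := adx j; exact: square_integrableM. Qed.

Lemma mean_step_integral2 : mean (fun w => step_integral w ^+ 2) =
  \sum_i \sum_j mean (fun w => xi i w * xi j w) * overlap (a i) (b i) (a j) (b j).
Proof.
have -> : (fun w => step_integral w ^+ 2) = fun w => \sum_i \sum_j
    (xi i w * (W (b i) w - W (a i) w)) * (xi j w * (W (b j) w - W (a j) w)).
  apply/funext => w; rewrite expr2 /step_integral mulr_suml.
  by apply: eq_bigr => i _; rewrite mulr_sumr.
rewrite mean_sum; last first.
  by move=> i; apply: integrable_rv_sum => j; exact: square_integrableM.
apply: eq_bigr => i _; rewrite mean_sum; last by move=> j; exact: square_integrableM.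
apply: eq_bigr => j _.
have [h1 h2 h3 h4 h5] := adx i; have [k1 k2 k3 k4 k5] := adx j.
by apply: (mean_increment_prod WG) => //; [exact: le_trans h1|exact: le_trans k1].
Qed.

Lemma jointly_measurable_step_fun : jointly_measurable alpha beta step_fun.
Proof.
apply: measurable_funTS; rewrite /step_fun.
apply: measurable_sum => i; apply: measurable_funM.
  have [_ _ _ _ [mx _]] := adx i.
  by apply: (measurableT_comp mx); exact: measurable_snd.
apply: (@measurableT_comp _ _ _ _ _ _ (\1_(`]a i, b i]) : R -> R) _ fst).
  exact: measurable_indic.
exact: measurable_fst.
Qed.

(** Both sides expand into the same double sum: time integrals of products of indicators and means
    of products of increments are both governed by [overlap]. *)
Lemma double_integral_step_fun2 :
  double_integral P alpha beta (fun s w => step_fun s w ^+ 2) =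
  (mean (fun w => step_integral w ^+ 2))%:E.
Proof.
rewrite mean_step_integral2 /double_integral.
have E w : (\int[mu]_(s in `[alpha, beta]) (step_fun s w ^+ 2)%:E)%E =
    (\sum_i \sum_j overlap (a i) (b i) (a j) (b j) * (xi i w * xi j w))%:E.
  transitivity (\int[mu]_(s in `[alpha, beta]) (\sum_i \sum_j
      ((xi i w * xi j w)%:E * (\1_(`]a i, b i]) s * \1_(`]a j, b j]) s)%:E)))%E.
    apply: eq_integral => s _; rewrite expr2 {1}/step_fun mulr_suml -sumEFin.
    apply: eq_bigr => i _; rewrite /step_fun mulr_sumr -sumEFin.
    by apply: eq_bigr => j _; rewrite -EFinM; congr EFin; ring.
  have iij i j : mu.-integrable `[alpha, beta] (fun s =>
      ((xi i w * xi j w)%:E * (\1_(`]a i, b i]) s * \1_(`]a j, b j]) s)%:E)%E).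
    have [h1 _ h3 _ _] := adx i; have [k1 _ k3 _ _] := adx j.
    by apply: integrableZl => //; exact: (integral_overlap h1 h3 k1 k3).1.
  rewrite integral_sum//; last by move=> i; apply: integrable_sum => // j _.
  rewrite -sumEFin; apply: eq_bigr => i _; rewrite integral_sum//.
  rewrite -sumEFin; apply: eq_bigr => j _.
  have [h1 _ h3 _ _] := adx i; have [k1 _ k3 _ _] := adx j.
  have [iO EO] := integral_overlap h1 h3 k1 k3.
  by rewrite integralZl// EO -EFinM mulrC.
under eq_integral do rewrite E.
have i1 i j : integrable_rv (fun w => overlap (a i) (b i) (a j) (b j) * (xi i w * xi j w)).
  exact: integrable_rvZ.
have i2 i : integrable_rv (fun w => \sum_j overlap (a i) (b i) (a j) (b j) * (xi i w * xi j w)).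
  exact: integrable_rv_sum.
transitivity (mean (fun w => \sum_i \sum_j overlap (a i) (b i) (a j) (b j) * (xi i w * xi j w)))%:E.
  rewrite /mean /Rintegral fineK//; apply: integrable_fin_num => //.
  exact: integrable_rv_sum.
congr EFin; rewrite mean_sum//; apply: eq_bigr => i _; rewrite mean_sum//.
by apply: eq_bigr => j _; rewrite meanZ// mulrC.
Qed.

End one_process.

Section difference.
Variables (I J : finType) (xi : I -> T -> R) (a b : I -> R).
Variables (xi' : J -> T -> R) (a' b' : J -> R).

Let xid (k : I + J) := match k with inl i => xi i | inr j => fun w => - xi' j w end.
Let ad (k : I + J) := match k with inl i => a i | inr j => a' j end.
Let bd (k : I + J) := match k with inl i => b i | inr j => b' j end.

Let step_fun_difference s w : step_fun xid ad bd s w =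
  step_fun xi a b s w - step_fun xi' a' b' s w.
Proof.
rewrite /step_fun big_sumType/=; congr +%R.
by rewrite -sumrN; apply: eq_bigr => j _; rewrite mulNr.
Qed.

Let step_integral_difference w : step_integral xid ad bd w =
  step_integral xi a b w - step_integral xi' a' b' w.
Proof.
rewrite /step_integral big_sumType/=; congr +%R.
by rewrite -sumrN; apply: eq_bigr => j _; rewrite mulNr.
Qed.

Lemma mean_step_integralB2 : adapted_steps xi a b -> adapted_steps xi' a' b' ->
  (mean (fun w => (step_integral xi a b w - step_integral xi' a' b' w) ^+ 2))%:E =
  double_integral P alpha beta
    (fun s w => (step_fun xi a b s w - step_fun xi' a' b' s w) ^+ 2).
Proof.
move=> H H'; have Hd : adapted_steps xid ad bd.
  case=> [i|j]; first exact: H.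
  have [h1 h2 h3 h4 h5] := H' j; split => //; last exact: square_integrableN.
  have -> : xid (inr j) = fun w => 0 - xi' j w by apply/funext => w; rewrite sub0r.
  apply: adaptedB => //; exact: (@adapted_cst _ _ _ (G (a' j)) 0).
have := double_integral_step_fun2 Hd.
have -> : (fun s w => step_fun xid ad bd s w ^+ 2) =
    fun s w => (step_fun xi a b s w - step_fun xi' a' b' s w) ^+ 2.
  by apply/funext => s; apply/funext => w; rewrite step_fun_difference.
move=> ->; congr (mean _)%:E.
by apply/funext => w; rewrite step_integral_difference.
Qed.

End difference.
End step_processes.
End ito_isometry.

(** * Distance from an Ito integral to the integral of a step process *)

Section ito_approximation.
Context d (T : measurableType d) (R : realType) (P : probability T R).
Variables (G : R -> set_system T) (W : R -> T -> R).
Hypothesis WG : wiener_wrt P G W.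
Local Notation mean := (mean P).
Local Notation integrable_rv := (integrable_rv P).
Local Notation square_integrable := (square_integrable P).
Local Notation mu := (@lebesgue_measure R).
Local Notation F := (fun s => <<s G s>>).

Lemma adapted_steps_simple_process alpha beta (S : simple_process T R) :
  sp_adapted P F alpha beta S ->
  adapted_steps P G alpha beta (fun k : 'I_(sp_size S) => sp_coef S k)
    (fun k => sp_time S k) (fun k => sp_time S k.+1).
Proof.
move=> [ta tb H].
have mono i j : (i <= j)%N -> (j <= sp_size S)%N -> sp_time S i <= sp_time S j.
  move=> ij; rewrite -(subnKC ij); elim: (j - i)%N => [|k IH]; first by rewrite addn0.
  rewrite addnS => ks; have [h _ _] := H _ ks.
  by apply: le_trans h; apply: IH; exact: ltnW.
move=> k; have [h1 h2 h3] := H k (ltn_ord k); split => //.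
- by rewrite -ta; apply: mono => //; exact: ltnW.
- by rewrite -tb; exact: mono.
have mk : measurable_fun setT (sp_coef S k).
  by case: WG => Gm _ _ _ _; exact: adapted_measurable (Gm _) h2.
split => //; apply/integrableP; split.
  by apply/measurable_EFinP; exact: measurable_funX.
move: h3; rewrite unlock; apply: le_lt_trans; rewrite le_eqVlt; apply/orP; left; apply/eqP.
by apply: eq_integral => w _ /=; rewrite ger0_norm// sqr_ge0.
Qed.

Lemma cvg0e_le (u : nat -> \bar R) (e : R) : u n @[n --> \oo] --> 0%E -> 0 < e ->
  \forall n \near \oo, (u n <= e%:E)%E.
Proof.
move=> /fine_cvgP[uf /cvgr0Pnorm_le /(_ e) H] e0; near=> n.
have un : u n \is a fin_num by near: n.
rewrite -(fineK un) lee_fin; apply: le_trans (ler_norm _) _.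
by near: n; exact: H.
Unshelve. all: by end_near. Qed.

Lemma square_integrable_ltey (X : T -> R) (e : R) : measurable_fun setT X ->
  ('E_P[fun w => (X w ^+ 2)%R] <= e%:E)%E ->
  square_integrable X /\ mean (fun w => X w ^+ 2) <= e.
Proof.
move=> mX Xe; have sX : square_integrable X.
  split => //; apply/integrableP; split.
    by apply/measurable_EFinP; exact: measurable_funX.
  apply: (@le_lt_trans _ _ e%:E); last exact: ltry.
  move: Xe; rewrite unlock; apply: le_trans; rewrite le_eqVlt; apply/orP; left; apply/eqP.
  by apply: eq_integral => w _ /=; rewrite ger0_norm// sqr_ge0.
by split => //; rewrite -lee_fin -expectation_mean//; exact: sX.2.
Qed.

(** The comparison goes through a simple process [S n] that is [eps]-close to the integrand and to
    [X]. Using (x + y)^2 <= 2 x^2 + 2 y^2 twice gives 2 eps + 2 (2 eps + 2 e) = 4 e + 6 eps, and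
    [eps] is arbitrary. *)
Lemma ito_step_approximation alpha beta H X (I : finType) (xi : I -> T -> R) a b e :
  0 <= alpha -> is_ito_integral P F alpha beta H W X ->
  adapted_steps P G alpha beta xi a b ->
  (double_integral P alpha beta (fun s w => (H s w - step_fun xi a b s w) ^+ 2)%R
    <= e%:E)%E ->
  square_integrable (fun w => X w - step_integral W xi a b w) /\
  mean (fun w => (X w - step_integral W xi a b w) ^+ 2) <= 4 * e.
Proof.
move=> alpha0 [[mH _ _] mX [S [Sad SH SX]]] adx He.
have mst := jointly_measurable_step_fun adx.
have key eps : 0 < eps ->
    square_integrable (fun w => X w - step_integral W xi a b w) /\
    mean (fun w => (X w - step_integral W xi a b w) ^+ 2) <= 4 * e + 6 * eps.
  move=> eps0.
  have [n [Hn Xn]] : exists n,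
      (double_integral P alpha beta (fun s w => (H s w - sp_fun (S n) s w) ^+ 2)%R
        <= eps%:E)%E /\
      ('E_P[fun w => ((X w - sp_integral W (S n) w) ^+ 2)%R] <= eps%:E)%E.
    near \oo => n; exists n; split; near: n; exact: cvg0e_le.
  have adS := adapted_steps_simple_process (Sad n).
  have mS := jointly_measurable_step_fun adS.
  have sS := square_integrable_step_integral WG alpha0 adS.
  have sI := square_integrable_step_integral WG alpha0 adx.
  have [sXS XSe] := square_integrable_ltey (measurable_funB mX sS.1) Xn.
  have sSI := square_integrableB sS sI.
  have D : (mean (fun w => (step_integral W (fun k : 'I_(sp_size (S n)) => sp_coef (S n) k)
      (fun k => sp_time (S n) k) (fun k => sp_time (S n) k.+1) w
       - step_integral W xi a b w) ^+ 2) <= 2 * eps + 2 * e).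
    rewrite -lee_fin (mean_step_integralB2 WG alpha0 adS adx).
    apply: (le_trans (double_integral_sqrB_le P mS mH mst)).
    rewrite (EFinD (2 * eps)) !(EFinM 2); apply: leeD; exact: lee_wpmul2l.
  have sXI : square_integrable (fun w => X w - step_integral W xi a b w).
    have := square_integrableD sXS sSI.
    by under eq_fun do rewrite subrKA.
  split => //.
  have : mean (fun w => (X w - step_integral W xi a b w) ^+ 2) <=
      2 * mean (fun w => (X w - sp_integral W (S n) w) ^+ 2) +
      2 * mean (fun w => (step_integral W (fun k : 'I_(sp_size (S n)) => sp_coef (S n) k)
      (fun k => sp_time (S n) k) (fun k => sp_time (S n) k.+1) w
       - step_integral W xi a b w) ^+ 2).
    rewrite -meanZ; last exact: sXS.2.
    rewrite -meanZ; last exact: sSI.2.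
    rewrite -meanD; [|apply: integrable_rvZ; exact: sXS.2|apply: integrable_rvZ; exact: sSI.2].
    apply: mean_le.
    - exact: sXI.2.
    - by apply: integrable_rvD; apply: integrable_rvZ; [exact: sXS.2|exact: sSI.2].
    - move=> w; rewrite -(subrKA (sp_integral W (S n) w)); exact: sqrD_le.
  lra.
split; first by have [] := key 1 ltr01.
apply/ler_addgt0Pr => eps eps0; have [] := key (eps / 6) _; first by rewrite divr_gt0.
by move=> _; have -> : 6 * (eps / 6) = eps by field.
Unshelve. all: by end_near. Qed.

End ito_approximation.

(** * Riemann sums of iterated integrals *)

Section iterated_integral.
Context d (T : measurableType d) (R : realType) (P : probability T R).
Variable (G : R -> set_system T).
Local Notation mean := (mean P).
Local Notation integrable_rv := (integrable_rv P).
Local Notation square_integrable := (square_integrable P).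
Local Notation mu := (@lebesgue_measure R).
Local Notation F := (fun s => <<s G s>>).

(** Identifies the inner integral with an increment of [V] up to a null event: the constant 1 is
    itself approximated with error 0 by a single step. *)
Lemma ito_integral_one V alpha beta X : wiener_wrt P G V ->
  0 <= alpha -> alpha <= beta ->
  is_ito_integral P F alpha beta (fun _ _ => 1) V X ->
  square_integrable (fun w => X w - (V beta w - V alpha w)) /\
  mean (fun w => (X w - (V beta w - V alpha w)) ^+ 2) <= 0.
Proof.
move=> VG alpha0 ab HX.
pose xi (_ : 'I_1) (_ : T) : R := 1.
have ad : adapted_steps P G alpha beta xi (fun=> alpha) (fun=> beta).
  move=> i; split => //; last exact: square_integrable_cst.
  exact: (@adapted_cst _ _ _ (G alpha) 1).
have := ito_step_approximation VG (e := 0) alpha0 HX ad; rewrite mulr0.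
have -> : (fun w => X w - step_integral V xi (fun=> alpha) (fun=> beta) w) =
    fun w => X w - (V beta w - V alpha w).
  by apply/funext => w; rewrite /step_integral big_ord1 mul1r.
have -> : (fun w => (X w - step_integral V xi (fun=> alpha) (fun=> beta) w) ^+ 2) =
    fun w => (X w - (V beta w - V alpha w)) ^+ 2.
  by apply/funext => w; rewrite /step_integral big_ord1 mul1r.
apply; rewrite /double_integral integral0_eq// => w _.
(* The step process is 1 on []alpha, beta]] only, so the point [alpha] is first dropped from the
   domain. *)
rewrite -integral_itv_obnd_cbnd; last first.
  have mst := jointly_measurable_step_fun ad.
  have m1 : jointly_measurable alpha beta (fun (_ : R) (_ : T) => 1 : R) by exact: measurable_cst.
  have := measurable_section w (jointly_measurable_sqrB m1 mst).
  apply: measurable_funS; first exact: measurable_itv.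
  by move=> x /=; rewrite !in_itv/= => /andP[/ltW -> ->].
rewrite integral0_eq// => s sI; rewrite /step_fun big_ord1 indicE mem_set//.
by rewrite mulr1 subrr expr0n.
Qed.

Definition grid (t : R) (N k : nat) : R := t + k%:R / N%:R.

Definition riemann_sum (V W : R -> T -> R) t N w : R :=
  \sum_(k < N) (V (grid t N k) w - V t w) *
               (W (grid t N k.+1) w - W (grid t N k) w).

Lemma grid0 t N : grid t N 0 = t.
Proof. by rewrite /grid mul0r addr0. Qed.

Lemma gridN t N : grid t N.+1 N.+1 = t + 1.
Proof. by rewrite /grid divff. Qed.

Lemma grid_le t N i j : (i <= j)%N -> grid t N i <= grid t N j.
Proof. by move=> ij; rewrite /grid lerD2l ler_wpM2r ?invr_ge0// ler_nat. Qed.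

Lemma gridS t N k : grid t N k.+1 - grid t N k = N%:R^-1.
Proof. by rewrite /grid -natr1 mulrDl mul1r; ring. Qed.

Lemma grid_step_fun (V : R -> T -> R) t N s : t <= s <= t + 1 ->
  exists2 k : 'I_N.+1, grid t N.+1 k <= s <= grid t N.+1 k.+1 &
  forall w, step_fun (fun (k : 'I_N.+1) w => V (grid t N.+1 k) w - V t w)
    (fun k => grid t N.+1 k) (fun k => grid t N.+1 k.+1) s w =
    V (grid t N.+1 k) w - V t w.
Proof.
move=> /andP[]; rewrite le_eqVlt => /predU1P[<- _|ts st1].
  (* At [s = t] no indicator is active, in agreement with the value V(t) - V(t) = 0 claimed for the
     first cell. *)
  exists ord0; first by rewrite grid0 lexx /= -{1}(grid0 t N.+1) grid_le.
  move=> w; rewrite /step_fun big1 ?grid0 ?subrr// => j _.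
  rewrite indicE memNset ?mulr0// /= in_itv/=.
  by rewrite ltNge -{1}(grid0 t N.+1) grid_le.
have exP : exists m, s <= grid t N.+1 m by exists N.+1; rewrite gridN.
case: (ex_minnP exP) => -[|k]; first by rewrite grid0 leNgt ts.
move=> sk kmin.
have kN : (k < N.+1)%N by apply: kmin; rewrite gridN.
have ks : grid t N.+1 k < s.
  by rewrite ltNge; apply/negP => /kmin; rewrite ltnn.
exists (Ordinal kN) => /=; first by rewrite sk ltW.
move=> w; rewrite /step_fun (bigD1 (Ordinal kN))//= indicE mem_set/=; last first.
  by rewrite in_itv/= ks sk.
rewrite mulr1 big1 ?addr0// => j /eqP jk.
rewrite indicE memNset ?mulr0//= in_itv/= => /andP[h1 h2].
have [jk'|kj|jk'] := ltngtP j k.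
- by move: ks; rewrite ltNge (le_trans h2)// grid_le.
- by move: h1; rewrite ltNge (le_trans sk)// grid_le.
- by apply: jk; apply: val_inj.
Qed.

(** For each [s], J(s) is almost surely V(s) - V(t), which differs from the step value by an
    increment of variance at most 1/(N+1). Splitting the square costs a factor 2, and
    [ito_step_approximation] a factor 4. *)
Lemma iterated_integral_riemann_sum V W t I N :
  wiener_wrt P G V -> wiener_wrt P G W -> 0 <= t ->
  is_iterated_ito_integral P F t V W I ->
  square_integrable (fun w => I w - riemann_sum V W t N.+1 w) /\
  mean (fun w => (I w - riemann_sum V W t N.+1 w) ^+ 2) <= 8 / N.+1%:R.
Proof.
move=> VG WG t0 [J [HJ HI]].
pose xi (k : 'I_N.+1) w := V (grid t N.+1 k) w - V t w.
pose a (k : 'I_N.+1) := grid t N.+1 k.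
pose b (k : 'I_N.+1) := grid t N.+1 k.+1.
have tg k : t <= grid t N.+1 k by rewrite -{1}(grid0 t N.+1) grid_le.
have ad : adapted_steps P G t (t + 1) xi a b.
  move=> k; split.
  - exact: tg.
  - by apply: grid_le.
  - by rewrite -(gridN t N) grid_le.
  - exact: (adapted_increment VG).
  - exact/has_moments_square_integrable/(increment_has_moments VG).
have -> : 8 / N.+1%:R = 4 * (2 / N.+1%:R) :> R by ring.
apply: (ito_step_approximation WG t0 HI ad).
have [[mJ _ _] _ _] := HI.
have mJx := jointly_measurable_sqrB mJ (jointly_measurable_step_fun ad).
(* What is known of [J s] holds for fixed [s] up to a null event depending on [s], so the
   expectation has to be taken first. *)
rewrite double_integral_swap//; last by move=> s w; exact: sqr_ge0.
apply: (@le_trans _ _ (\int[mu]_(s in `[t, (t + 1)%R]) (cst (2 / N.+1%:R)%:E s))%E).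
  apply: ge0_le_integral => //.
  - by move=> s _; apply: integral_ge0 => w _; rewrite lee_fin sqr_ge0.
  - by apply: measurable_outer_integral => // s w; exact: sqr_ge0.
  move=> s /=; rewrite in_itv/= => st.
  have /andP[ts _] := st.
  have [sJ EJ] := ito_integral_one VG t0 ts (HJ s st).
  have [k /andP[ks sk] Ek] := @grid_step_fun V t N s st.
  have [hV EV] : has_moments P (fun w => V s w - V (grid t N.+1 k) w) /\
      mean (fun w => (V s w - V (grid t N.+1 k) w) ^+ 2) = s - grid t N.+1 k.
    case: VG => _ _ _ _ /(_ _ _ (le_trans t0 (tg k)) ks)[hV ->]; split => //.
    by rewrite sqr_sqrtr ?subr_ge0//= mulr1.
  have sV := has_moments_square_integrable hV.
  have D w : J s w - step_fun xi a b s w =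
      (J s w - (V s w - V t w)) + (V s w - V (grid t N.+1 k) w).
    by rewrite (Ek w); ring.
  have sD : square_integrable (fun w => J s w - step_fun xi a b s w).
    by under eq_fun do rewrite D; exact: square_integrableD.
  have -> : (\int[P]_w ((J s w - step_fun xi a b s w) ^+ 2)%:E)%E =
      (mean (fun w => (J s w - step_fun xi a b s w) ^+ 2))%:E.
    by rewrite -expectation_mean ?unlock//; exact: sD.2.
  rewrite lee_fin.
  apply: (@le_trans _ _ (2 * mean (fun w => (J s w - (V s w - V t w)) ^+ 2) +
      2 * mean (fun w => (V s w - V (grid t N.+1 k) w) ^+ 2))).
    rewrite -meanZ; last exact: sJ.2.
    rewrite -meanZ; last exact: sV.2.
    rewrite -meanD; [|apply: integrable_rvZ; exact: sJ.2|apply: integrable_rvZ; exact: sV.2].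
    apply: mean_le.
    - exact: sD.2.
    - by apply: integrable_rvD; apply: integrable_rvZ; [exact: sJ.2|exact: sV.2].
    - by move=> w; rewrite D; exact: sqrD_le.
  have := gridS t N.+1 k; rewrite EV; move: EJ sk ks.
  set r := N.+1%:R^-1; set m := mean _; set g := grid _ _ _; set g' := grid _ _ _.
  move: r m g g' => r m g g'; lra.
rewrite integral_cst//= lebesgue_measure_itv/= lte_fin ltrDl ltr01.
by rewrite -EFinD addrAC subrr add0r mule1.
Qed.

End iterated_integral.

(** * Moments of the Riemann sums *)

Section walk.
Context d (T : measurableType d) (R : realType) (P : probability T R).
Variables (W1 W2 : R -> {RV P >-> R}) (t : R).
Hypotheses (hW1 : wiener_process W1) (hW2 : wiener_process W2).
Hypotheses (hW12 : independent_processes W1 W2) (t0 : 0 <= t).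
Local Notation mean := (mean P).
Local Notation integrable_rv := (integrable_rv P).
Local Notation has_moments := (has_moments P).

(** The increment of [W2] is split off first, against a past in which [W1] is already observed until
    [u]; then the increment of [W1] is split off from [Z]. *)
Lemma mean_adaptedM_increments Z r u p q : 0 <= r -> r < u ->
  adapted (bifiltration W1 W2 r r) Z -> integrable_rv Z ->
  mean (fun w => Z w * (W1 u w - W1 r w) ^+ p * (W2 u w - W2 r w) ^+ q) =
  mean Z * (Num.sqrt (u - r) ^+ (p + q) *
            (gaussian_moment p * gaussian_moment q)%:R).
Proof.
move=> r0 ru aZ iZ.
have [hY mY] := increment_moments hW2 r0 (ltW ru).
have [i1 E1] := mean_adaptedM_incrementX (wiener_wrt1 hW1 hW12) p r0 (ltW ru) aZ iZ.
have [|_ ->] := independent_meanM _ i1 (hY q).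
  have := @increment_independent2 _ _ _ _ W1 W2 u r u hW2 hW12 r0 ru.
  apply: independent_sub.
    apply: adaptedM.
      by apply: adapted_sub aZ; apply: bifiltration_sub => //; exact: ltW.
    apply: adaptedX; apply: adaptedB; apply: adapted_bifiltration1.
      by rewrite lexx andbT (le_trans r0)// ltW.
    by rewrite r0 ltW.
  by apply: (@sigma_rv_comp _ _ _ _ (fun x => x ^+ q)); exact: measurable_funX.
by rewrite E1 mY natrM exprD; ring.
Qed.

Variable N : nat.
Local Notation tau := (grid t N.+1).

Let X k w := W1 (tau k) w - W1 t w.
Let Y k w := W2 (tau k) w - W2 t w.
Let dX k w := W1 (tau k.+1) w - W1 (tau k) w.
Let dY k w := W2 (tau k.+1) w - W2 (tau k) w.
Let I k w := \sum_(j < k) X j w * dY j w.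
Let K k w := \sum_(j < k) Y j w * dX j w.

Let tau_ge k : t <= tau k.
Proof. by rewrite -{1}(grid0 t N.+1) grid_le. Qed.

Let tau0 k : 0 <= tau k. Proof. exact: le_trans (tau_ge k). Qed.

Let moments k : [/\ has_moments (X k), has_moments (Y k),
  has_moments (I k) & has_moments (K k)].
Proof.
have hX j : has_moments (X j) by have [] := increment_moments hW1 t0 (tau_ge j).
have hY j : has_moments (Y j) by have [] := increment_moments hW2 t0 (tau_ge j).
have hdX j : has_moments (dX j).
  by have [] := increment_moments hW1 (tau0 j) (grid_le t N.+1 (leqnSn j)).
have hdY j : has_moments (dY j).
  by have [] := increment_moments hW2 (tau0 j) (grid_le t N.+1 (leqnSn j)).
by split=> //; apply: has_moments_sum => j; exact: has_momentsM.
Qed.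

Let adapted_walk k : let G := bifiltration W1 W2 (tau k) (tau k) in
  [/\ adapted G (X k), adapted G (Y k), adapted G (I k) & adapted G (K k)].
Proof.
have aX j : adapted (bifiltration W1 W2 (tau j) (tau j)) (X j).
  by apply: adaptedB; apply: adapted_bifiltration1; rewrite ?lexx ?tau0 ?t0 ?tau_ge.
have aY j : adapted (bifiltration W1 W2 (tau j) (tau j)) (Y j).
  by apply: adaptedB; apply: adapted_bifiltration2; rewrite ?lexx ?tau0 ?t0 ?tau_ge.
move=> G; rewrite {}/G; split; [exact: aX|exact: aY| |]; elim: k => [|k IH].
- rewrite (_ : I 0 = fun=> 0); last by apply/funext => w; rewrite /I big_ord0.
  exact: (@adapted_cst _ _ _ (bifiltration W1 W2 (tau 0) (tau 0)) 0).
- rewrite (_ : I k.+1 = fun w => I k w + X k w * dY k w); last first.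
    by apply/funext => w; rewrite /I big_ord_recr.
  have le1 := grid_le t N.+1 (leqnSn k).
  have sub := @bifiltration_sub _ _ _ P W1 W2 _ _ _ _ le1 le1.
  apply: adaptedD; first exact: adapted_sub sub _.
  apply: adaptedM; first exact: adapted_sub sub _.
  by apply: adaptedB; apply: adapted_bifiltration2; rewrite tau0 ?lexx.
- rewrite (_ : K 0 = fun=> 0); last by apply/funext => w; rewrite /K big_ord0.
  exact: (@adapted_cst _ _ _ (bifiltration W1 W2 (tau 0) (tau 0)) 0).
- rewrite (_ : K k.+1 = fun w => K k w + Y k w * dX k w); last first.
    by apply/funext => w; rewrite /K big_ord_recr.
  have le1 := grid_le t N.+1 (leqnSn k).
  have sub := @bifiltration_sub _ _ _ P W1 W2 _ _ _ _ le1 le1.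
  apply: adaptedD; first exact: adapted_sub sub _.
  apply: adaptedM; first exact: adapted_sub sub _.
  by apply: adaptedB; apply: adapted_bifiltration1; rewrite tau0 ?lexx.
Qed.

Let Z k a b c e w := X k w ^+ a * Y k w ^+ b * I k w ^+ c * K k w ^+ e.

Let Z_moments k a b c e : has_moments (Z k a b c e).
Proof.
have [hX hY hI hK] := moments k.
by do 3 (apply: has_momentsM; last exact: has_momentsX); exact: has_momentsX.
Qed.

Let Z_adapted k a b c e :
  adapted (bifiltration W1 W2 (tau k) (tau k)) (Z k a b c e).
Proof.
have [hX hY hI hK] := adapted_walk k.
by do 3 (apply: adaptedM; last exact: adaptedX); exact: adaptedX.
Qed.

Lemma binomial_expansion_step (x y i k p q : R) a b c e :
  (x + p) ^+ a * (y + q) ^+ b * (i + x * q) ^+ c * (k + y * p) ^+ e =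
  \sum_(i1 < a.+1) \sum_(j < b.+1) \sum_(l < c.+1) \sum_(m < e.+1)
    ('C(a, i1) * 'C(b, j) * 'C(c, l) * 'C(e, m))%:R *
    (x ^+ (a - i1 + l) * y ^+ (b - j + m) * i ^+ (c - l) * k ^+ (e - m) *
     p ^+ (i1 + m) * q ^+ (j + l)).
Proof.
have binE (u v : R) n : (u + v) ^+ n = \sum_(j < n.+1) 'C(n, j)%:R * (u ^+ (n - j) * v ^+ j).
  by rewrite exprDn; apply: eq_bigr => j _; rewrite mulr_natl.
rewrite !binE -!mulrA mulr_suml; apply: eq_bigr => i1 _.
rewrite mulr_suml mulr_sumr; apply: eq_bigr => j _.
rewrite mulr_suml !mulr_sumr; apply: eq_bigr => l _.
rewrite !mulr_sumr; apply: eq_bigr => m _.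
rewrite (exprMn _ x q) (exprMn _ y p) (exprD x) (exprD y) (exprD p) (exprD q) !natrM.
move: (x ^+ (a - i1)) (x ^+ l) (y ^+ (b - j)) (y ^+ m) (i ^+ (c - l)).
move: (k ^+ (e - m)) (p ^+ i1) (p ^+ m) (q ^+ j) (q ^+ l).
move: ('C(a, i1)%:R : R) ('C(b, j)%:R : R) ('C(c, l)%:R : R) ('C(e, m)%:R : R).
by move=> *; ring.
Qed.

Lemma mean_walk_step k a b c e :
  mean (Z k.+1 a b c e) =
  \sum_(i < a.+1) \sum_(j < b.+1) \sum_(l < c.+1) \sum_(m < e.+1)
    ('C(a, i) * 'C(b, j) * 'C(c, l) * 'C(e, m))%:R *
    (mean (Z k (a - i + l) (b - j + m) (c - l) (e - m)) *
     (Num.sqrt N.+1%:R^-1 ^+ (i + m + (j + l)) *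
      (gaussian_moment (i + m) * gaussian_moment (j + l))%:R)).
Proof.
pose B i j l m w := ('C(a, i) * 'C(b, j) * 'C(c, l) * 'C(e, m))%:R *
  (Z k (a - i + l) (b - j + m) (c - l) (e - m) w * dX k w ^+ (i + m) * dY k w ^+ (j + l)).
have le1 := grid_le t N.+1 (leqnSn k).
have [hdX _] := increment_moments hW1 (tau0 k) le1.
have [hdY _] := increment_moments hW2 (tau0 k) le1.
have iZ i j l m : integrable_rv (fun w => Z k (a - i + l) (b - j + m) (c - l) (e - m) w *
    dX k w ^+ (i + m) * dY k w ^+ (j + l)).
  apply/has_moments_integrable; apply: has_momentsM; last exact: has_momentsX.
  by apply: has_momentsM; last exact: has_momentsX.
have iB i j l m : integrable_rv (B i j l m) by exact: integrable_rvZ.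
have -> : Z k.+1 a b c e = fun w =>
    \sum_(i < a.+1) \sum_(j < b.+1) \sum_(l < c.+1) \sum_(m < e.+1) B i j l m w.
  apply/funext => w; rewrite /B /Z -binomial_expansion_step.
  have -> : X k.+1 w = X k w + dX k w by rewrite /X /dX; ring.
  have -> : Y k.+1 w = Y k w + dY k w by rewrite /Y /dY; ring.
  have -> : I k.+1 w = I k w + X k w * dY k w by rewrite /I big_ord_recr.
  by have -> : K k.+1 w = K k w + Y k w * dX k w by rewrite /K big_ord_recr.
rewrite mean_sum; last by move=> i; do 3 apply: integrable_rv_sum => ?.
apply: eq_bigr => i _.
rewrite mean_sum; last by move=> j; do 2 apply: integrable_rv_sum => ?.
apply: eq_bigr => j _; rewrite mean_sum; last by move=> l; apply: integrable_rv_sum.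
apply: eq_bigr => l _; rewrite mean_sum//.
apply: eq_bigr => m _; rewrite meanZ//; congr (_ * _).
rewrite mean_adaptedM_increments ?gridS//.
- by rewrite -subr_gt0 gridS invr_gt0.
- exact/has_moments_integrable.
Qed.

(** Brownian scaling: [walk_moment] uses steps of unit variance, and the true step size enters once
    for each factor [X] or [Y] and twice for each factor [I] or [K]. *)
Lemma mean_walk k a b c e : mean (Z k a b c e) =
  Num.sqrt N.+1%:R^-1 ^+ (a + b + c.*2 + e.*2) * walk_moment k a b c e.
Proof.
elim: k a b c e => [|k IH] a b c e.
  have -> : Z 0 a b c e = fun=> (a + b + c + e == 0)%N%:R.
    apply/funext => w; rewrite /Z /X /Y /I /K grid0 !subrr !big_ord0 !expr0n.
    by rewrite -!natrM !mulnb !addn_eq0.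
  rewrite mean_cst /walk_moment/=.
  case: eqP => [|_]; last by rewrite mulr0.
  by case: a b c e => [|?] [|?] [|?] [|?]//; rewrite expr0 mulr1.
rewrite mean_walk_step /walk_moment iterS -/(walk_moment k) /moment_step mulr_sumr.
apply: eq_bigr => -[i ia] _; rewrite mulr_sumr; apply: eq_bigr => -[j jb] _.
rewrite mulr_sumr; apply: eq_bigr => -[l lc] _; rewrite mulr_sumr.
apply: eq_bigr => -[m me] _ /=; rewrite IH !natrM.
have -> : (a + b + c.*2 + e.*2 = (a - i + l + (b - j + m) + (c - l).*2 + (e - m).*2) +
    (i + m + (j + l)))%N by lia.
by rewrite [in RHS]exprD; ring.
Qed.

End walk.

(* Binary numbers, because the values are too large to be computed in unary. *)
Fixpoint leading_coefN (p a b c d : nat) : BinNums.N :=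
  let scale n := BinNat.N.mul (BinNat.N.of_nat n) in
  match p with
  | 0 => BinNat.N.one
  | p'.+1 => foldr BinNat.N.add BinNat.N.zero
      [:: scale 'C(a, 2)%N (leading_coefN p' (a - 2)%N b c d);
          scale (a * d)%N (leading_coefN p' (a - 1)%N b.+1 c (d - 1)%N);
          scale 'C(d, 2)%N (leading_coefN p' a b.+2 c (d - 2)%N);
          scale 'C(b, 2)%N (leading_coefN p' a (b - 2)%N c d);
          scale (b * c)%N (leading_coefN p' a.+1 (b - 1)%N (c - 1)%N d);
          scale 'C(c, 2)%N (leading_coefN p' a.+2 b (c - 2)%N d)]
  end.

Lemma leading_coefNE p a b c d :
  BinNat.N.to_nat (leading_coefN p a b c d) = leading_coef p a b c d.
Proof.
elim: p a b c d => // p IH a b c d.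
rewrite /= !Nnat.N2Nat.inj_add !Nnat.N2Nat.inj_mul !Nnat.Nat2N.id !IH.
by rewrite !plusE !multE addn0 !addnA.
Qed.

(** The cross-multiplied equation in binary numbers can be decided by [vm_compute]. *)
Lemma leading_coef_ratio (R : realType) p a b c d (m q : nat) :
  BinNat.N.mul (leading_coefN p a b c d) (BinNat.N.of_nat q) =
    BinNat.N.mul (BinNat.N.of_nat m) (BinNat.N.of_nat p`!) ->
  (0 < q)%N ->
  (leading_coef p a b c d)%:R / p`!%:R = m%:R / q%:R :> R.
Proof.
move=> /(congr1 BinNat.N.to_nat); rewrite !Nnat.N2Nat.inj_mul !Nnat.Nat2N.id leading_coefNE.
move=> H q0; apply/eqP; rewrite eqr_div ?pnatr_eq0 -?lt0n ?fact_gt0//.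
by rewrite -!natrM; apply/eqP; congr _%:R.
Qed.

(** * Passage to the limit *)

Section mixed_moments.
Context d (T : measurableType d) (R : realType) (P : probability T R).
Variables (W1 W2 : R -> {RV P >-> R}) (t : R).
Hypotheses (hW1 : wiener_process W1) (hW2 : wiener_process W2).
Hypotheses (hW12 : independent_processes W1 W2) (t0 : 0 <= t).
Local Notation mean := (mean P).

Let dW1 w := W1 (t + 1) w - W1 t w.
Let dW2 w := W2 (t + 1) w - W2 t w.
Let I n := riemann_sum W1 W2 t n.+1.
Let K n := riemann_sum W2 W1 t n.+1.

Lemma cvg_mean_riemann_sums p a b c e : (a + b + c.*2 + e.*2 = p.*2)%N ->
  mean (fun w => dW1 w ^+ a * dW2 w ^+ b * I n w ^+ c * K n w ^+ e) @[n --> \oo]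
  --> ((leading_coef p a b c e)%:R / p`!%:R : R).
Proof.
move=> w.
have -> : (fun n => mean (fun w => dW1 w ^+ a * dW2 w ^+ b * I n w ^+ c * K n w ^+ e)) =
    fun n => walk_moment n.+1 a b c e / n.+1%:R ^+ p.
  apply/funext => n; have := mean_walk hW1 hW2 hW12 t0 n n.+1 a b c e.
  rewrite gridN w -mul2n exprM sqr_sqrtr// exprVn mulrC => <-.
  by [].
rewrite (cvg_shiftS (fun n => walk_moment n a b c e / n%:R ^+ p)).
exact: walk_moment_cvg.
Qed.

Lemma has_moments_riemann_sum (V W : R -> {RV P >-> R}) N :
  wiener_process V -> wiener_process W ->
  has_moments P (riemann_sum V W t N.+1).
Proof.
move=> hV hW; apply: has_moments_sum => k.
have tg j : t <= grid t N.+1 j by rewrite -{1}(grid0 t N.+1) grid_le.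
apply: has_momentsM; first by have [] := increment_moments hV t0 (tg k).
by have [] := increment_moments hW (le_trans t0 (tg k)) (grid_le t N.+1 (leqnSn k)).
Qed.

Lemma cvg_ub (u : nat -> R) (l : R) : u n @[n --> \oo] --> l ->
  exists C, forall n, u n <= C.
Proof.
move=> ul; have [M [Mr H]] : bounded_fun u.
  by apply: cvg_seq_bounded; apply/cvg_ex; exists l.
exists (M + 1) => n; apply: le_trans (ler_norm _) _.
by apply: (H (M + 1)) => //; rewrite ltrDl.
Qed.

Let bounded_I : bounded_moments P I.
Proof.
split=> [n|p]; first exact: has_moments_riemann_sum.
(* The power [p.*2] of a double sum has weight twice [p.*2], hence the level [p.*2]; the bound comes
   from convergence of these moments. *)
have [|C HC] := cvg_ub (@cvg_mean_riemann_sums p.*2 0 0 p.*2 0 _).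
  by rewrite !add0n addn0.
exists C => n; have := HC n.
by under eq_fun do rewrite !expr0 !mul1r mulr1.
Qed.

Let bounded_K : bounded_moments P K.
Proof.
split=> [n|p]; first exact: has_moments_riemann_sum.
have [|C HC] := cvg_ub (@cvg_mean_riemann_sums p.*2 0 0 0 p.*2 _).
  by rewrite !add0n.
exists C => n; have := HC n.
by under eq_fun do rewrite !expr0 !mul1r.
Qed.

Lemma moment_cvg_iterated_integral (V W : R -> {RV P >-> R}) X :
  wiener_wrt P (fun s => bifiltration W1 W2 s s) V ->
  wiener_wrt P (fun s => bifiltration W1 W2 s s) W ->
  bounded_moments P (fun n => riemann_sum V W t n.+1) ->
  is_iterated_ito_integral P (wiener_filtration W1 W2) t V W X ->
  moment_cvg P (fun n => riemann_sum V W t n.+1) X.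
Proof.
move=> GV GW bU HX.
have A n := iterated_integral_riemann_sum n GV GW t0 HX.
have E n : (fun w => (riemann_sum V W t n.+1 w - X w) ^+ 2) =
    fun w => (X w - riemann_sum V W t n.+1 w) ^+ 2.
  by apply/funext => w; ring.
apply: moment_cvg_of_square => //.
- by case: HX => J [_ []].
- by move=> n; rewrite E; exact: (A n).1.2.
apply: (@cvg_mean_le0 _ _ (fun n => 8 * n.+1%:R^-1)).
- by move=> n; apply: mean_ge0 => w; exact: sqr_ge0.
- by move=> n; rewrite E; exact: (A n).2.
rewrite -[X in _ --> X](mulr0 8); apply: cvgM; first exact: cvg_cst.
exact: cvg_harmonic.
Qed.

Variables (I12 I21 : T -> R).
Hypotheses (hI12 : is_iterated_ito_integral P (wiener_filtration W1 W2) t W1 W2 I12)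
  (hI21 : is_iterated_ito_integral P (wiener_filtration W1 W2) t W2 W1 I21).

(** The moments of the sums converge both to the mixed moment and to the normalized leading
    coefficient. *)
Lemma mixed_moment p a b c e : (a + b + c.*2 + e.*2 = p.*2)%N ->
  'E_P[(fun w => dW1 w ^+ a * dW2 w ^+ b * I12 w ^+ c * I21 w ^+ e)%R]%E =
  ((leading_coef p a b c e)%:R / p`!%:R)%:E.
Proof.
move=> w.
have tt : t <= t + 1 by rewrite lerDl.
have [h1 _] := increment_moments hW1 t0 tt.
have [h2 _] := increment_moments hW2 t0 tt.
have G1 := wiener_wrt1 hW1 hW12; have G2 := wiener_wrt2 hW2 hW12.
have H12 := moment_cvg_iterated_integral G1 G2 bounded_I hI12.
have H21 := moment_cvg_iterated_integral G2 G1 bounded_K hI21.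
have H := moment_cvgM (moment_cvgM (moment_cvgM
  (moment_cvgX a (moment_cvg_cst h1)) (moment_cvgX b (moment_cvg_cst h2)))
  (moment_cvgX c H12)) (moment_cvgX e H21).
rewrite expectation_mean; last by case: H => _ /has_moments_integrable.
congr EFin; have L := moment_cvg_mean H.
by rewrite -(cvg_lim _ L)//; apply/cvg_lim => //; exact: cvg_mean_riemann_sums.
Qed.

End mixed_moments.

Theorem mainTheorem4 (d : measure_display) (T : measurableType d)
    (R : realType) (P : probability T R) (W1 W2 : R -> {RV P >-> R}) (t : R)
    (I12 I21 : T -> R)
    (hW1 : wiener_process W1) (hW2 : wiener_process W2)
    (hW12 : independent_processes W1 W2) (ht : 0 <= t)
    (hI12 : is_iterated_ito_integral P (wiener_filtration W1 W2) t W1 W2 I12)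
    (hI21 : is_iterated_ito_integral P (wiener_filtration W1 W2) t W2 W1 I21) :
  let dW1 : T -> R := fun w => W1 (t + 1) w - W1 t w in
  let dW2 : T -> R := fun w => W2 (t + 1) w - W2 t w in
  'E_P[(fun w => dW1 w ^+ 4 * I12 w * I21 w)%R]%E = 2%:E /\
  'E_P[(fun w => dW1 w ^+ 2 * dW2 w ^+ 2 * I12 w * I21 w)%R]%E = (5 / 3)%:E /\
  'E_P[(fun w => dW1 w ^+ 6 * I12 w * I21 w)%R]%E = 15%:E /\
  'E_P[(fun w => dW1 w ^+ 4 * dW2 w ^+ 2 * I12 w * I21 w)%R]%E = 9%:E /\
  'E_P[(fun w => dW1 w ^+ 2 * I12 w ^+ 2 * I21 w ^+ 2)%R]%E = (49 / 20)%:E /\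
  'E_P[(fun w => dW1 w ^+ 8 * I12 w * I21 w)%R]%E = 140%:E /\
  'E_P[(fun w => dW1 w ^+ 6 * dW2 w ^+ 2 * I12 w * I21 w)%R]%E = 65%:E /\
  'E_P[(fun w => dW1 w ^+ 4 * dW2 w ^+ 4 * I12 w * I21 w)%R]%E = 48%:E /\
  'E_P[(fun w => dW1 w ^+ 4 * I12 w ^+ 2 * I21 w ^+ 2)%R]%E = (339 / 20)%:E /\
  'E_P[(fun w => dW1 w ^+ 2 * dW2 w ^+ 2 * I12 w ^+ 2 * I21 w ^+ 2)%R]%E
    = (679 / 60)%:E.
Proof.
move=> dW1 dW2.
have M (f : T -> R) p a b c e m q : (a + b + c.*2 + e.*2 = p.*2)%N ->
    BinNat.N.mul (leading_coefN p a b c e) (BinNat.N.of_nat q) =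
      BinNat.N.mul (BinNat.N.of_nat m) (BinNat.N.of_nat p`!) ->
    (0 < q)%N ->
    (forall w, f w = dW1 w ^+ a * dW2 w ^+ b * I12 w ^+ c * I21 w ^+ e) ->
    ('E_P[f])%E = (m%:R / q%:R)%:E.
  move=> wp lead q0 fE; have -> : f = fun w => dW1 w ^+ a * dW2 w ^+ b * I12 w ^+ c * I21 w ^+ e.
    by apply/funext => w; exact: fE.
  rewrite (mixed_moment hW1 hW2 hW12 ht hI12 hI21 wp).
  by rewrite (leading_coef_ratio R lead q0).
have M1 (f : T -> R) p a b c e m : (a + b + c.*2 + e.*2 = p.*2)%N ->
    leading_coefN p a b c e =
      BinNat.N.mul (BinNat.N.of_nat m) (BinNat.N.of_nat p`!) ->
    (forall w, f w = dW1 w ^+ a * dW2 w ^+ b * I12 w ^+ c * I21 w ^+ e) ->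
    ('E_P[f])%E = m%:R%:E.
  move=> wp lead fE; rewrite (M f p a b c e m 1%N) ?divr1//.
  by rewrite lead; exact: BinNat.N.mul_1_r.
do ![split].
(* The numbers are the half weight [p], the four exponents and, for [M], the numerator and
   denominator of the value. *)
- by apply: (M1 _ 4 4 0 1 1) => [||w]; [|vm_compute|ring].
- by apply: (M _ 4 2 2 1 1 5 3) => [|||w]; [|vm_compute| |ring].
- by apply: (M1 _ 5 6 0 1 1) => [||w]; [|vm_compute|ring].
- by apply: (M1 _ 5 4 2 1 1) => [||w]; [|vm_compute|ring].
- by apply: (M _ 5 2 0 2 2 49 20) => [|||w]; [|vm_compute| |ring].
- by apply: (M1 _ 6 8 0 1 1) => [||w]; [|vm_compute|ring].
- by apply: (M1 _ 6 6 2 1 1) => [||w]; [|vm_compute|ring].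
- by apply: (M1 _ 6 4 4 1 1) => [||w]; [|vm_compute|ring].
- by apply: (M _ 6 4 0 2 2 339 20) => [|||w]; [|vm_compute| |ring].
- by apply: (M _ 6 2 2 2 2 679 60) => [|||w]; [|vm_compute| |ring].
Qed.
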